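(* Let $A(\cdot):[0,\tau]\to\mathcal{L}(D,X)$ be Lipschitz continuous in the sense that $$\|A(t)x-A(s)x\|\le|t-s|\,\|x\|_D\qquad(t,s\in[0,\tau],\ x\in D).$$ Assume that $A(t)\in\mathscr{MR}$ for every $t\in[0,\tau]$ and let $C\in\mathcal{L}(D,Y)$. Then for every $p\in(1,\infty)$: if $(C,A(t))$ is $p$-admissible for all $t\in[0,\tau]$, then $(C,A(\cdot))$ is $p$-admissible.
   Context: $\tau>0$ is fixed. $(X,\|\cdot\|)$, $(D,\|\cdot\|_D)$ and $(Y,\|\cdot\|_Y)$ are Banach spaces with $D$ continuously and densely embedded into $X$. Maximal regularity. For $q\in(1,\infty)$ and a bounded interval $(a,b)$, $\mathrm{MR}_q(a,b):=W^{1,q}(a,b;X)\cap L^q(a,b;D)$. An operator $B\in\mathcal{L}(D,X)$ has $L^q$-maximal regularity if for all bounded intervals $(a,b)$ and all $f\in L^q(a,b;X)$ there is a unique $u\in\mathrm{MR}_q(a,b)$ with $\dot u(t)+Bu(t)=f(t)$ for a.e. $t\in[a,b]$ and $u(a)=0$. This is known to be independent of $q\in(1,\infty)$; one writes $B\in\mathscr{MR}$. If $B\in\mathscr{MR}$, then $-B$ with domain $D$ generates an analytic semigroup $(e^{-rB})_{r\ge0}$ on $X$. Evolution family. Under the hypotheses of the statement, for every $s\in[0,\tau)$, $q\in(1,\infty)$ and every $x$ in the trace space $\mathrm{Tr}_q=\{u(s):u\in\mathrm{MR}_q(s,\tau)\}\supset D$, there is a unique $u\in\mathrm{MR}_q(s,\tau)$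 with $\dot u(t)+A(t)u(t)=0$ for a.e. $t\in[s,\tau]$ and $u(s)=x$; one sets $U(t,s)x:=u(t)$. The operators $U(t,s)$, $0\le s\le t\le\tau$, extend to bounded operators on $X$ forming an evolution family on $X$ (that is, $U(t,s)=U(t,r)U(r,s)$ and $U(s,s)=I$ for $s\le r\le t$, with $(t,s)\mapsto U(t,s)$ strongly continuous), and $U(t,s)x\in D$ for a.e. $t\in[s,\tau]$. Admissibility. Let $\theta\in(1,\infty)$. - $(C,A(t))$ is $\theta$-admissible if for some (equivalently, all) $a>0$ there is a constant $\gamma>0$ with $\int_0^a\|Ce^{-rA(t)}x\|_Y^\theta\,dr\le\gamma^\theta\|x\|^\theta$ for all $x\in D$. - $(C,A(\cdot))$ is $\theta$-admissible if for every $s\in[0,\tau)$ there is a constant $\gamma>0$ with $\int_s^\tau\|CU(t,s)x\|_Y^\theta\,dt\le\gamma^\theta\|x\|^\theta$ for all $x\in D$. *)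

(* Defs.v *)
From HB Require Import structures.
From mathcomp Require Import all_boot all_order all_algebra.
From mathcomp Require Import all_classical all_reals all_analysis.

Set Implicit Arguments.
Unset Strict Implicit.
Unset Printing Implicit Defensive.

Import Order.TTheory GRing.Theory Num.Theory.
Import numFieldNormedType.Exports.

Local Open Scope classical_set_scope.
Local Open Scope ring_scope.

(* Functions on an interval are represented by total functions on R; only
   their values on the interval matter. *)

Section Bochner.
Context {R : realType} {E : completeNormedModType R}.
Implicit Types (a b q : R) (f g : R -> E).

Definition simple_function f :=
  finite_set (range f) /\ forall x, measurable (f @^-1` [set x]).

Definition simple_integral a b f : E :=
  \sum_(x \in range f)
    fine (lebesgue_measure (`]a, b[ `&` f @^-1` [set x])) *: x.

Definition simple_approximation a b (s : nat -> R -> E) f :=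
  (forall n, simple_function (s n)) /\
  {ae lebesgue_measure, forall t, t \in `]a, b[ -> s n t @[n --> \oo] --> f t}.

Definition strongly_measurable a b f := exists s, simple_approximation a b s f.

(* f is Bochner integrable on (a, b) and its integral is I. *)
Definition has_bochner_integral a b f (I : E) :=
  exists s, [/\ simple_approximation a b s f,
    (\int[lebesgue_measure]_(t in `]a, b[) `|f t - s n t|%:E)%E
      @[n --> \oo] --> 0%E &
    simple_integral a b (s n) @[n --> \oo] --> I].

Definition in_Lq q a b f :=
  strongly_measurable a b f /\
  (\int[lebesgue_measure]_(t in `]a, b[) (`|f t| `^ q)%:E < +oo)%E.

(* u is the continuous representative on [a, b] of an element of
   W^{1,q}(a, b; E), and g is its derivative. *)
Definition W1q_derivative q a b u g :=
  [/\ in_Lq q a b u, in_Lq q a b g &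
    forall t, t \in `[a, b] -> has_bochner_integral a t g (u t - u a)].

End Bochner.

Section MaximalRegularity.
Context {R : realType} {X D : completeNormedModType R}.
(* j is the embedding of D into X. *)
Variable j : {linear D -> X}.

(* u lies in MR_q(a, b), with derivative g, and v is u seen as a D-valued
   function. *)
Definition MR_data (q a b : R) (u g : R -> X) (v : R -> D) :=
  [/\ W1q_derivative q a b u g, in_Lq q a b v &
    {ae lebesgue_measure, forall t, t \in `]a, b[ -> u t = j (v t)}].

Definition in_MR (q a b : R) (u : R -> X) := exists g v, MR_data q a b u g v.

(* u lies in MR_q(a, b) and u'(t) + A(t) u(t) = f(t) for a.e. t. *)
Definition MR_solution (q a b : R) (A : R -> D -> X) (f u : R -> X) :=
  exists g v, MR_data q a b u g v /\
    {ae lebesgue_measure, forall t, t \in `]a, b[ -> g t + A t (v t) = f t}.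

Definition Lq_maximal_regularity (q : R) (B : D -> X) :=
  forall a b : R, a < b -> forall f : R -> X, in_Lq q a b f ->
    (exists u, MR_solution q a b (fun=> B) f u /\ u a = 0) /\
    (forall u1 u2, MR_solution q a b (fun=> B) f u1 -> u1 a = 0 ->
                   MR_solution q a b (fun=> B) f u2 -> u2 a = 0 ->
                   forall t, t \in `[a, b] -> u1 t = u2 t).

Definition maximal_regularity (B : D -> X) :=
  forall q : R, 1 < q -> Lq_maximal_regularity q B.

Definition trace_space (q s tau : R) : set X :=
  [set x | exists u, in_MR q s tau u /\ u s = x].

Definition C0_semigroup (T : R -> {linear X -> X}) :=
  [/\ forall r, 0 <= r -> continuous (T r),
      forall x, T 0 x = x,
      forall r s x, 0 <= r -> 0 <= s -> T (r + s) x = T r (T s x) &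
      forall x, T r x @[r --> 0^'+] --> x].

(* T = (e^{-rB})_{r >= 0}: the infinitesimal generator of T is exactly -B,
   with domain D. *)
Definition semigroup_generated (B : D -> X) (T : R -> {linear X -> X}) :=
  C0_semigroup T /\
  forall x y : X, r^-1 *: (T r x - x) @[r --> 0^'+] --> y <->
    exists2 d : D, x = j d & y = - B d.

Definition evolution_family (tau : R) (U : R -> R -> {linear X -> X}) :=
  [/\ forall t s, 0 <= s -> s <= t -> t <= tau -> continuous (U t s),
      forall s x, 0 <= s -> s <= tau -> U s s x = x,
      forall t r s x, 0 <= s -> s <= r -> r <= t -> t <= tau ->
        U t s x = U t r (U r s x) &
      forall x, {within [set p : R * R |
                          [/\ 0 <= p.2, p.2 <= p.1 & p.1 <= tau]],
                 continuous (fun p : R * R => U p.1 p.2 x)}].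

(* On every trace space, U(., s)x is the unique solution of
   u'(t) + A(t) u(t) = 0, u(s) = x. Since the trace spaces contain the dense
   subspace D, this determines the bounded operators U(t, s), s < tau. *)
Definition solves_Cauchy_problem (tau : R) (A : R -> D -> X)
    (U : R -> R -> {linear X -> X}) :=
  forall s q x, 0 <= s -> s < tau -> 1 < q -> trace_space q s tau x ->
    (exists u, MR_solution q s tau A (cst 0) u /\ u s = x) /\
    (forall u, MR_solution q s tau A (cst 0) u -> u s = x ->
       forall t, t \in `[s, tau] -> U t s x = u t).

(* The element of D represented by x; the value 0 when x is not in D is
   arbitrary and is only met on null sets of times below. *)
Definition to_D (x : X) : D := xget 0 [set d | j d = x].

Context {Y : completeNormedModType R}.

Definition admissible (theta : R) (C : D -> Y) (T : R -> {linear X -> X}) :=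
  exists2 a : R, 0 < a & exists2 gamma : R, 0 < gamma &
    forall x : D,
      (\int[lebesgue_measure]_(r in `]0%R, a[)
          (`|C (to_D (T r (j x)))| `^ theta)%:E
        <= (gamma `^ theta * `|j x| `^ theta)%:E)%E.

Definition evolution_admissible (theta tau : R) (C : D -> Y)
    (U : R -> R -> {linear X -> X}) :=
  forall s : R, 0 <= s -> s < tau -> exists2 gamma : R, 0 < gamma &
    forall x : D,
      (\int[lebesgue_measure]_(t in `]s, tau[)
          (`|C (to_D (U t s (j x)))| `^ theta)%:E
        <= (gamma `^ theta * `|j x| `^ theta)%:E)%E.

End MaximalRegularity.

(* Main.v *)
Require Import Defs.
From HB Require Import structures.
From mathcomp Require Import all_boot all_order all_algebra finmap.
From mathcomp Require Import all_classical all_reals all_analysis.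
From mathcomp Require Import measurable_realfun ring lra.

Set Implicit Arguments.
Unset Strict Implicit.
Unset Printing Implicit Defensive.

Import Order.TTheory GRing.Theory Num.Theory.
Import numFieldNormedType.Exports.

Local Open Scope classical_set_scope.
Local Open Scope ring_scope.

(** Fix s and x in D, and let u = U(., s) x, with v the same orbit seen in D.
    Freezing the operator at time s compares u with a semigroup orbit: the
    difference w = u - e^(-(. - s) A(s)) x vanishes at s and solves
    w' + A(s) w = (A(s) - A(t)) v, whose right-hand side is bounded by
    (t - s) |v(t)| because A is Lipschitz.  The semigroup orbit is controlled by
    the admissibility of (C, A(s)), and w by maximal regularity, which bounds w
    in L^p(D) by the right-hand side in L^p(X)
    ([maximal_regularity_estimate]).  It remains to bound (t - s) v(t) in L^p(D)
    by |x|: this is the smoothing effect ([smoothing_estimate]).  Indeed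
    z = (t - a) u solves z' + A(t0) z = (A(t0) - A(t)) z + u with z(a) = 0; on a
    short interval around t0 the first term on the right is absorbed, which
    leaves the L^p(X) norm of u, and that is bounded by |x| through the uniform
    boundedness principle ([evolution_operator_bound]).  This settles a short
    interval after s ([initial_estimate]).  Away from s the smoothing effect
    bounds v itself in L^p(D), hence C v, on a neighbourhood of every time, and
    [real_induction] puts the neighbourhoods together.

    Maximal regularity asserts existence and uniqueness of solutions; the
    estimate that comes with it is proved by a gliding hump.  If no constant
    worked on arbitrarily short intervals, one could place on successive
    disjoint subintervals of (0, 1) forcing terms that are small in L^p(X) and
    whose solutions started from rest are large in L^p(D).  Each of them is added
    to the total force only if the response to the previous ones is still small
    on its interval.  By causality, later terms do not change what happened
    before, so the total force lies in L^p(X) and its solution has L^p(D) mass at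
    least 1 on each of the infinitely many intervals, which is absurd.  The only
    operations on solutions are linear combinations, restrictions and
    translations in time.  Applied to t |-> t d, the estimate also bounds the
    norm of D by the graph norm ([graph_norm_bound]); this makes semigroup orbits
    continuous in D, and therefore solutions in the sense of maximal regularity
    ([MR_data_orbit]).

    The product t |-> (t - a) u(t) must be recognised as a Sobolev function
    ([W1q_derivativeM]); this rests on the elementary theory of the Bochner
    integral developed first. *)

(** * Integrals of nonnegative functions *)

Import HBNNSimple.
Section LowerIntegral.
Context d (T : measurableType d) (R : realType) (mu : {measure set T -> \bar R}).
Local Open Scope ereal_scope.

(** The integral of a nonnegative function, measurable or not, is a supremum
    over simple minorants, and a minorant of h1 becomes a minorant of h2 once it
    is cut to 0 on the exceptional null set. *)
Lemma ae_le_integral (D : set T) (h1 h2 : T -> \bar R) :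
  (forall t, D t -> 0 <= h1 t) -> (forall t, D t -> 0 <= h2 t) ->
  {ae mu, forall t, D t -> h1 t <= h2 t} ->
  \int[mu]_(t in D) h1 t <= \int[mu]_(t in D) h2 t.
Proof.
move=> h10 h20 [N [mN muN sub]]; rewrite !ge0_integralE//.
apply: ge_ereal_sup => _ [phi /= le_phi <-].
have mNC := measurableC mN.
pose psi := mul_nnsfun phi (indic_nnsfun R mNC).
apply: le_ereal_sup_tmp; exists (sintegral mu psi).
  exists psi => //= t.
  rewrite /= /psi /=; rewrite mindicE; have [tN|tN] := boolP (t \in ~` N); last first.
    by rewrite mulr0 erestrict_ge0.
  rewrite mulr1 (le_trans (le_phi t))// /patch; case: ifPn => // /set_mem tD.
  apply: contrapT => nle; move/set_mem : tN; apply; apply: sub => /= /(_ tD).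
  by move/nle.
rewrite -!integralT_nnsfun.
rewrite (ge0_negligible_integral mN)//; last 2 first.
- exact/measurable_EFinP.
- by move=> t _; rewrite lee_fin.
rewrite [leRHS](ge0_negligible_integral mN)//; last 2 first.
- exact/measurable_EFinP.
- by move=> t _; rewrite lee_fin.
rewrite le_eqVlt; apply/orP; left; apply/eqP.
apply: eq_integral => t; rewrite inE => -[_ tN] /=.
by rewrite mindicE mem_set// mulr1.
Qed.
End LowerIntegral.

Lemma ae_eq_integral_ge0 d (T : measurableType d) (R : realType)
    (mu : {measure set T -> \bar R}) (D : set T) (h1 h2 : T -> \bar R) :
  (forall t, D t -> 0 <= h1 t)%E -> (forall t, D t -> 0 <= h2 t)%E ->
  {ae mu, forall t, D t -> h1 t = h2 t} ->
  (\int[mu]_(t in D) h1 t = \int[mu]_(t in D) h2 t)%E.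
Proof.
move=> h10 h20 h12; apply/eqP; rewrite eq_le; apply/andP; split;
  apply: ae_le_integral => //; apply: filterS h12 => t h Dt;
  by rewrite h.
Qed.

#[export] Instance ae_lebesgue_filter (R : realType) :
  Filter (nbhs (almost_everywhere (@lebesgue_measure R))) :=
  ae_filter_ringOfSetsType
    (lebesgue_measure : {measure set (measurableTypeR R) -> \bar R}).

(** * Maps with finitely many values *)
Section SimpleMaps.
Context {R : realType}.
Local Notation mu := (@lebesgue_measure R).

(** For a Banach space T these are the simple functions; other codomains serve to
    treat several simple functions at once, through the map of their values. *)
Definition simple_map T (h : R -> T) :=
  finite_set (range h) /\ forall z, measurable (h @^-1` [set z]).

Lemma simple_map_preimage T (h : R -> T) (A : set T) :
  simple_map h -> measurable (h @^-1` A).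
Proof.
move=> [fh mh].
have -> : h @^-1` A = \bigcup_(z in range h `&` A) (h @^-1` [set z]).
  apply/seteqP; split => [t At|t [z [_ Az] /= tz]]; last by rewrite /= tz.
  by exists (h t) => //; split => //; exists t.
by apply: fin_bigcup_measurable => //; exact: finite_setIl.
Qed.

Lemma simple_map_comp T T' (phi : T -> T') (h : R -> T) :
  simple_map h -> simple_map (phi \o h).
Proof.
move=> sh; split; last by move=> z; exact: (simple_map_preimage (phi @^-1` [set z])).
by rewrite -(image_comp h phi); apply: finite_image; case: sh.
Qed.

Lemma simple_map_pair T T' (h : R -> T) (k : R -> T') :
  simple_map h -> simple_map k -> simple_map (fun t => (h t, k t)).
Proof.
move=> [fh mh] [fk mk]; split.
  apply: (@sub_finite_set _ _ (range h `*` range k)); last exact: finite_setX.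
  by move=> _ [t _ <-]; split => /=; exists t.
move=> [x y]; have -> : (fun t => (h t, k t)) @^-1` [set (x, y)] =
  h @^-1` [set x] `&` k @^-1` [set y].
  by apply/seteqP; split => t /=; [case | case=> -> ->].
exact: measurableI.
Qed.

Lemma simple_map_comp2 T1 T2 T (phi : T1 -> T2 -> T) (h : R -> T1) (k : R -> T2) :
  simple_map h -> simple_map k -> simple_map (fun t => phi (h t) (k t)).
Proof.
move=> sh sk.
exact: (simple_map_comp (fun z => phi z.1 z.2) (simple_map_pair sh sk)).
Qed.

Lemma simple_map_mem (A : set R) : measurable A ->
  simple_map (fun t => t \in A).
Proof.
move=> mA; split.
  apply: (@sub_finite_set _ _ [set true; false]) => // -[]; by [left|right].
case.
- have -> // : (fun t => t \in A) @^-1` [set true] = A.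
  by apply/seteqP; split => t /=; [move/set_mem|move/mem_set].
- have -> : (fun t => t \in A) @^-1` [set false] = ~` A.
    by apply/seteqP; split => t /=; [move/negbT; rewrite notin_setE|
      rewrite -notin_setE => /negbTE].
  exact: measurableC.
Qed.

Lemma simple_map_if T (A : set R) (h k : R -> T) : measurable A ->
  simple_map h -> simple_map k -> simple_map (fun t => if t \in A then h t else k t).
Proof.
move=> mA sh sk; have sA := simple_map_mem mA.
exact: (simple_map_comp2 (fun b z => if b then z.1 else z.2) sA
  (simple_map_pair sh sk)).
Qed.

Lemma simple_map_cst T (z : T) : simple_map (fun=> z : T).
Proof.
split; first by apply: (@sub_finite_set _ _ [set z]) => // _ [t _ <-].
move=> y; have [->|ney] := pselect (z = y).
  have -> : (fun=> y) @^-1` [set y] = [set: R] by apply/seteqP; split.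
  exact: measurableT.
by have -> : (fun=> z) @^-1` [set y] = set0 :> set R by apply/seteqP; split.
Qed.

Lemma simple_map_measurable T (h : R -> T) (phi : T -> R) :
  simple_map h -> measurable_fun setT (phi \o h).
Proof.
by move=> sh _ B _; rewrite setTI; exact: (simple_map_preimage (phi @^-1` B)).
Qed.

Lemma itv_measure_lty (a b : R) (P : set R) : measurable P ->
  (mu (`]a, b[ `&` P) < +oo)%E.
Proof.
move=> mP; apply: (@le_lt_trans _ _ (mu `]a, b[)).
  by apply: le_measure; rewrite ?inE//; exact: measurableI.
by rewrite lebesgue_measure_itv/=; case: ifP => _; rewrite ltry.
Qed.

Section IntegralOfSimpleMaps.
Context {T : choiceType} (a b : R) (h : R -> T).
Hypothesis sh : simple_map h.
Let fiber z := `]a, b[%classic `&` h @^-1` [set z].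
Let mfiber z : measurable (fiber z).
Proof. by apply: measurableI => //; case: sh. Qed.
Let weight z := fine (mu (fiber z)).

Let cover : `]a, b[%classic = \big[setU/set0]_(z <- fset_set (range h)) fiber z.
Proof.
rewrite -bigcup_seq; apply/seteqP; split => [t tab|t [z _ []]]//.
exists (h t) => //=; rewrite in_fset_set; last by case: sh.
by apply/mem_set; exists t.
Qed.

Let triv : trivIset [set: T] fiber.
Proof.
apply/trivIsetP => x y _ _ /eqP xy; apply/seteqP; split => // t [[_ tx] [_ ty]].
by apply: xy; rewrite -tx -ty.
Qed.

Lemma integral_simple_map (phi : T -> R) : (forall z, 0 <= phi z) ->
  (\int[mu]_(t in `]a, b[) (phi (h t))%:E =
   (\sum_(z \in range h) weight z * phi z)%:E)%E.
Proof.
move=> phi0; rewrite cover ge0_integral_bigsetU//=; first last.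
- by move=> t _; rewrite lee_fin.
- apply/measurable_EFinP; apply: measurable_funTS.
  exact: simple_map_measurable.
- exact: sub_trivIset triv.
rewrite fsbig_finite/=; last by case: sh.
rewrite -sumEFin; apply: eq_bigr => z _.
rewrite (eq_integral (cst (phi z)%:E)); last first.
  by move=> t /set_mem[_ /= <-].
have fin : mu (fiber z) \is a fin_num.
  by rewrite ge0_fin_numE//; apply: itv_measure_lty; case: sh.
by rewrite integral_cst ?EFinM ?/weight ?fineK 1?muleC//; exact: mfiber.
Qed.

Lemma measure_simple_map (A : set T) :
  fine (mu (`]a, b[ `&` h @^-1` A)) =
  \sum_(z \in range h) if z \in A then weight z else 0.
Proof.
have mA := simple_map_preimage A sh.
have := @integral_simple_map (fun z => (z \in A)%:R) (fun z => ler0n _ _).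
have -> : (\int[mu]_(t in `]a, b[) ((h t \in A)%:R)%:E =
    \int[mu]_(t in `]a, b[) (\1_(h @^-1` A) t)%:E)%E.
  apply: eq_integral => t _; rewrite indicE.
  have -> // : (h t \in A) = (t \in h @^-1` A).
  by apply/idP/idP => /set_mem At; apply/mem_set.
rewrite integral_indic// setIC => ->/=.
apply: eq_fsbigr => z _; case: ifPn => _; by rewrite ?mulr1 ?mulr0.
Qed.

(** The values of h are grouped according to their image under phi; with h a pair
    of simple functions and phi a combination of the projections, this is the
    additivity of the integral of simple functions. *)
Lemma simple_integral_comp {E : completeNormedModType R} (phi : T -> E) :
  simple_integral a b (phi \o h) = \sum_(z \in range h) weight z *: phi z.
Proof.
have [fh mh] := sh.
have [fp mp] := simple_map_comp phi sh.
rewrite /simple_integral.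
rewrite (eq_fsbigr (fun x => \sum_(z \in range h)
    if phi z == x then weight z *: phi z else 0)); last first.
  move=> x _; rewrite (measure_simple_map (phi @^-1` [set x])).
  rewrite !fsbig_finite//= scaler_suml; apply: eq_bigr => z _.
  have -> : (z \in phi @^-1` [set x]) = (phi z == x).
    by apply/idP/idP => [/set_mem/eqP//|/eqP ?]; exact/mem_set.
  by case: eqP => [->|]; rewrite ?scale0r.
rewrite exchange_fsbig//=; apply: eq_fsbigr => z /set_mem [t _ <-].
rewrite fsbig_finite//= (big_fsetD1 (phi (h t)))/=; last first.
  by rewrite in_fset_set//; apply/mem_set; exists t.
rewrite eqxx big1_fset ?addr0// => x; rewrite in_fsetD1 => /andP[+ _] _.
by rewrite eq_sym => /negbTE ->.
Qed.

End IntegralOfSimpleMaps.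

End SimpleMaps.

(** * Strong measurability *)
Section StrongMeasurability.
Context {R : realType}.
Local Notation mu := (@lebesgue_measure R).
Implicit Types (a b c d : R) (H : R -> R).

(** The norm of a strongly measurable function is only almost everywhere equal to
    a Borel function, as strong measurability ignores null sets. *)
Definition ae_measurable a b H := exists h : R -> R,
  [/\ measurable_fun setT h, forall t, 0 <= h t &
      {ae mu, forall t, t \in `]a, b[ -> H t = h t}].

Lemma ae_subinterval a b c d (P : R -> Prop) : a <= c -> d <= b ->
  {ae mu, forall t, t \in `]a, b[ -> P t} ->
  {ae mu, forall t, t \in `]c, d[ -> P t}.
Proof.
move=> ac db; apply: filterS => t Pt tcd; apply: Pt.
move: tcd; rewrite !in_itv/= => /andP[ct td].
by rewrite (le_lt_trans ac ct) (lt_le_trans td db).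
Qed.

Lemma ae_measurable_sub a b c d H : a <= c -> d <= b ->
  ae_measurable a b H -> ae_measurable c d H.
Proof. by move=> ac db [h [mh h0 Hh]]; exists h; split => //; exact: ae_subinterval Hh. Qed.

Lemma ae_measurableZ a b k H : 0 <= k ->
  ae_measurable a b H -> ae_measurable a b (fun t => k * H t).
Proof.
move=> k0 [h [mh h0 Hh]]; exists (fun t => k * h t); split.
- exact: measurable_funM.
- by move=> t; rewrite mulr_ge0.
- by apply: filterS Hh => t Ht tab; rewrite Ht.
Qed.

Lemma ae_measurableD a b H K :
  ae_measurable a b H -> ae_measurable a b K -> ae_measurable a b (fun t => H t + K t).
Proof.
move=> [h [mh h0 Hh]] [k [mk k0 Hk]]; exists (fun t => h t + k t); split.
- exact: measurable_funD.
- by move=> t; rewrite addr_ge0.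
- by apply: filterS2 Hh Hk => t Ht Kt tab; rewrite Ht// Kt.
Qed.

Lemma ae_measurable_cst a b k : 0 <= k -> ae_measurable a b (cst k).
Proof. by move=> k0; exists (cst k); split => //; apply: aeW. Qed.

Lemma ae_integralE a b H (h : R -> R) : (forall t, 0 <= H t) -> (forall t, 0 <= h t) ->
  {ae mu, forall t, t \in `]a, b[ -> H t = h t} ->
  (\int[mu]_(t in `]a, b[) (H t)%:E = \int[mu]_(t in `]a, b[) (h t)%:E)%E.
Proof.
move=> H0 h0 Hh; apply: ae_eq_integral_ge0.
- by move=> t _; rewrite lee_fin.
- by move=> t _; rewrite lee_fin.
- by apply: filterS Hh => t e tab; rewrite e.
Qed.

Lemma ae_integralD a b H K : (forall t, 0 <= H t) -> (forall t, 0 <= K t) ->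
  ae_measurable a b H -> ae_measurable a b K ->
  (\int[mu]_(t in `]a, b[) (H t + K t)%:E =
   \int[mu]_(t in `]a, b[) (H t)%:E + \int[mu]_(t in `]a, b[) (K t)%:E)%E.
Proof.
move=> H0 K0 [h [mh h0 Hh]] [k [mk k0 Kk]].
rewrite (ae_integralE H0 h0 Hh) (ae_integralE K0 k0 Kk).
rewrite (@ae_integralE _ _ (fun t => H t + K t) (fun t => h t + k t)); first last.
- by apply: filterS2 Hh Kk => t Ht Kt tab; rewrite Ht// Kt.
- by move=> t; rewrite addr_ge0.
- by move=> t; rewrite addr_ge0.
rewrite -ge0_integralD//=.
- by move=> t _; rewrite lee_fin.
- by apply/measurable_EFinP; exact: measurable_funTS.
- by move=> t _; rewrite lee_fin.
- by apply/measurable_EFinP; exact: measurable_funTS.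
Qed.

Lemma ae_integralZ a b k H : 0 <= k -> (forall t, 0 <= H t) ->
  ae_measurable a b H ->
  (\int[mu]_(t in `]a, b[) (k * H t)%:E = k%:E * \int[mu]_(t in `]a, b[) (H t)%:E)%E.
Proof.
move=> k0 H0 [h [mh h0 Hh]].
rewrite (ae_integralE H0 h0 Hh).
rewrite (@ae_integralE _ _ (fun t => k * H t) (fun t => k * h t)); first last.
- by apply: filterS Hh => t Ht tab; rewrite Ht.
- by move=> t; rewrite mulr_ge0.
- by move=> t; rewrite mulr_ge0.
rewrite -ge0_integralZl_EFin//=.
- by move=> t _; rewrite lee_fin.
- by apply/measurable_EFinP; exact: measurable_funTS.
Qed.

Lemma ae_integral_split a b c H : a <= c -> c <= b -> (forall t, 0 <= H t) ->
  ae_measurable a b H ->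
  (\int[mu]_(t in `]a, b[) (H t)%:E =
   \int[mu]_(t in `]a, c[) (H t)%:E + \int[mu]_(t in `]c, b[) (H t)%:E)%E.
Proof.
move=> ac cb H0 [h [mh h0 Hh]].
rewrite (ae_integralE H0 h0 Hh).
rewrite (ae_integralE H0 h0 (ae_subinterval (lexx a) cb Hh)).
rewrite (ae_integralE H0 h0 (ae_subinterval ac (lexx b) Hh)).
have me (A : set R) : measurable_fun A (EFin \o h).
  by apply/measurable_EFinP; exact: measurable_funTS.
have [->|nac] := eqVneq a c; first by rewrite set_itvoo0 integral_set0 add0e.
have [->|ncb] := eqVneq c b; first by rewrite set_itvoo0 integral_set0 adde0.
have lac : a < c by rewrite lt_neqAle nac.
have lcb : c < b by rewrite lt_neqAle ncb.
rewrite -(@integral_itv_bndoo _ c b (EFin \o h) true true)//.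
rewrite -ge0_integral_setU//=.
- by congr integral; rewrite -itv_bndbnd_setU// bnd_simp// ltW.
- exact: me.
- by move=> t _; rewrite lee_fin.
- apply/disj_setPS => t [] /=; rewrite !in_itv/= => /andP[_ tc] /andP[ct _].
  by move: (lt_le_trans tc ct); rewrite ltxx.
Qed.

Lemma ae_integral_le a b H K : (forall t, 0 <= H t) -> (forall t, 0 <= K t) ->
  {ae mu, forall t, t \in `]a, b[ -> H t <= K t} ->
  (\int[mu]_(t in `]a, b[) (H t)%:E <= \int[mu]_(t in `]a, b[) (K t)%:E)%E.
Proof.
move=> H0 K0 HK; apply: ae_le_integral.
- by move=> t _; rewrite lee_fin.
- by move=> t _; rewrite lee_fin.
- by apply: filterS HK => t le tab; rewrite lee_fin; exact: le.
Qed.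

Lemma integral_cst_itv a b k : a <= b ->
  (\int[mu]_(t in `]a, b[) k%:E = (k * (b - a))%:E)%E.
Proof.
move=> ab; transitivity (k%:E * mu `]a, b[)%E; first exact: integral_cst.
rewrite lebesgue_measure_itv/=.
rewrite lte_fin; have [lt|ge] := ltP a b; first by rewrite -EFinB -EFinM.
have -> : a = b by apply/eqP; rewrite eq_le ab.
by rewrite mule0 subrr mulr0.
Qed.

Lemma integral_lty_fin a b H : (forall t, 0 <= H t) ->
  (\int[mu]_(t in `]a, b[) (H t)%:E < +oo)%E ->
  exists2 r : R, 0 <= r & (\int[mu]_(t in `]a, b[) (H t)%:E = r%:E)%E.
Proof.
move=> H0 fin.
have i0 : (0 <= \int[mu]_(t in `]a, b[) (H t)%:E)%E.
  by apply: integral_ge0 => t _; rewrite lee_fin.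
exists (fine (\int[mu]_(t in `]a, b[) (H t)%:E)%E); first exact: fine_ge0.
by rewrite fineK// ge0_fin_numE.
Qed.

Section Banach.
Context {E : completeNormedModType R}.
Implicit Types f g : R -> E.

(** The approximating functions, put to 0 on the exceptional null set, have norms
    that converge everywhere. *)
Lemma strongly_measurable_norm a b f (phi : R -> R) :
  measurable_fun setT phi -> (forall x, 0 <= x -> 0 <= phi x) ->
  strongly_measurable a b f -> ae_measurable a b (fun t => phi `|f t|).
Proof.
move=> mphi phi0 [s [ss [N [mN N0 sub]]]].
pose A := `]a, b[%classic `\` N.
have mA : measurable A by exact: measurableD.
pose n0 (g : R -> E) t := if t \in A then `|g t| else 0.
have ms n : measurable_fun setT (n0 (s n)).
  have sn : simple_map (n0 (s n)).
    apply: simple_map_if => //; last exact: simple_map_cst.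
    exact: (simple_map_comp Num.norm (ss n)).
  exact: (simple_map_measurable id sn).
have mf : measurable_fun setT (n0 f).
  apply: (measurable_fun_cvg ms) => t _; rewrite /n0.
  case: ifPn => [/set_mem[tab tN]|_]; last exact: cvg_cst.
  apply: cvg_norm; apply: contrapT => ncv; apply: tN; apply: sub => /= /(_ tab).
  exact: ncv.
exists (phi \o n0 f); split.
- exact: measurableT_comp.
- by move=> t; apply: phi0; rewrite /n0; case: ifP.
- exists N; split => // t /= ne; apply: contrapT => tN; apply: ne => tab.
  by rewrite /n0 mem_set.
Qed.

Lemma strongly_measurable_ae a b f g :
  {ae mu, forall t, t \in `]a, b[ -> f t = g t} ->
  strongly_measurable a b f -> strongly_measurable a b g.
Proof.
move=> fg [s [ss cv]]; exists s; split => //.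
by apply: filterS2 fg cv => t e cvt tab; rewrite -e//; exact: cvt.
Qed.

Lemma strongly_measurable_sub a b c d f : a <= c -> d <= b ->
  strongly_measurable a b f -> strongly_measurable c d f.
Proof. by move=> ac db [s [ss cv]]; exists s; split => //; exact: ae_subinterval cv. Qed.

Lemma strongly_measurable_cst a b (x : E) : strongly_measurable a b (cst x).
Proof.
exists (fun _ => cst x); split; first by move=> n; exact: simple_map_cst.
by apply: aeW => t _; exact: cvg_cst.
Qed.

End Banach.

Lemma strongly_measurable_comp2 (E F G : completeNormedModType R) a b
    (phi : E -> F -> G) (f : R -> E) (g : R -> F) :
  continuous (fun z : E * F => phi z.1 z.2) ->
  strongly_measurable a b f -> strongly_measurable a b g ->
  strongly_measurable a b (fun t => phi (f t) (g t)).
Proof.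
move=> cphi [s [ss cs]] [r [sr cr]].
exists (fun n t => phi (s n t) (r n t)); split.
  by move=> n; exact: (simple_map_comp2 phi (ss n) (sr n)).
apply: filterS2 cs cr => t st rt tab.
apply: (@cvg_comp _ _ _ (fun n => (s n t, r n t)) (fun z => phi z.1 z.2) _
  (nbhs (f t, g t))); last exact: (cphi (f t, g t)).
by apply: cvg_pair; [exact: st|exact: rt].
Qed.

Lemma strongly_measurable_comp (E F : completeNormedModType R) a b
    (phi : E -> F) (f : R -> E) : continuous phi ->
  strongly_measurable a b f -> strongly_measurable a b (phi \o f).
Proof.
move=> cphi [s [ss cs]]; exists (fun n => phi \o s n); split.
  by move=> n; exact: (simple_map_comp phi (ss n)).
apply: filterS cs => t st tab.
by apply: (@cvg_comp _ _ _ (fun n => s n t) phi _ (nbhs (f t))); [exact: st|exact: cphi].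
Qed.

Lemma strongly_measurableD (E : completeNormedModType R) a b (f g : R -> E) :
  strongly_measurable a b f -> strongly_measurable a b g ->
  strongly_measurable a b (fun t => f t + g t).
Proof. by apply: strongly_measurable_comp2; exact: add_continuous. Qed.

Lemma strongly_measurableZ (E : completeNormedModType R) a b (k : R) (f : R -> E) :
  strongly_measurable a b f -> strongly_measurable a b (fun t => k *: f t).
Proof. by apply: strongly_measurable_comp; exact: scaler_continuous. Qed.

Lemma strongly_measurable_scale (E : completeNormedModType R) a b (k : R -> R)
    (f : R -> E) : strongly_measurable a b (k : R -> R^o) ->
  strongly_measurable a b f -> strongly_measurable a b (fun t => k t *: f t).
Proof.
by apply: (@strongly_measurable_comp2 R^o E E a b (fun k x => k *: x));
  exact: scale_continuous.
Qed.

(** On ]a, b[ the function is sampled at the points a + k / (n + 1). *)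
Lemma strongly_measurable_continuous (E : completeNormedModType R) a b (f : R -> E) :
  (forall t, t \in `]a, b[ -> {for t, continuous f}) -> strongly_measurable a b f.
Proof.
move=> cf.
pose k n (t : R) : nat := Num.truncn ((t - a) * n.+1%:R).
have mk n : measurable_fun setT (fun t => (k n t)%:R : R).
  apply: nondecreasing_measurable => // x y xy; rewrite ler_nat.
  by apply: le_truncn; rewrite ler_wpM2r// lerB.
pose h n t := if t \in `]a, b[%classic then k n t else 0%N.
have sh n : simple_map (h n).
  split.
    apply: (@sub_finite_set _ _ `I_((k n b).+1)); last exact: finite_II.
    move=> _ [t _ <-] /=; rewrite /h; case: ifPn => // /set_mem/=.
    rewrite in_itv/= => /andP[_ tb]; rewrite ltnS; apply: le_truncn.
    by rewrite ler_wpM2r// lerB// ltW.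
  move=> m; pose h' t : R := (k n t)%:R * \1_(`]a, b[%classic) t.
  have mh' : measurable_fun setT h'.
    by apply: measurable_funM => //; exact: measurable_indic.
  have -> : h n @^-1` [set m] = h' @^-1` [set m%:R].
    apply/seteqP; rewrite /h /h'; split => t /=; rewrite indicE; case: ifP => _.
    + by rewrite mulr1 => ->.
    + by rewrite mulr0 => <-.
    + by rewrite mulr1 => /eqP; rewrite eqr_nat => /eqP.
    + by rewrite mulr0 => /eqP; rewrite (eqr_nat _ 0) => /eqP.
  rewrite -[X in measurable X]setTI; exact: mh'.
exists (fun n t => if t \in `]a, b[%classic then f (a + (h n t)%:R / n.+1%:R) else 0); split.
  move=> n; apply: simple_map_if => //; last exact: simple_map_cst.
  exact: (simple_map_comp (fun m : nat => f (a + m%:R / n.+1%:R)) (sh n)).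
apply: aeW => t tab.
have tA : t \in `]a, b[%classic by apply/mem_set.
rewrite /h tA.
apply: (@cvg_comp _ _ _ (fun n => a + (k n t)%:R / n.+1%:R) f _ (nbhs t)); last exact: cf.
move: tab; rewrite in_itv/= => /andP[at_ _].
apply: (@squeeze_cvgr _ _ _ _ (fun n => t - n.+1%:R^-1) (cst t)); last 2 first.
- rewrite -[X in _ --> X]subr0; apply: cvgB; first exact: cvg_cst.
  exact: cvg_harmonic.
- exact: cvg_cst.
apply: nearW => n /=.
have n0 : 0 < n.+1%:R :> R by rewrite ltr0n.
have x0 : 0 <= (t - a) * n.+1%:R by rewrite mulr_ge0// subr_ge0 ltW.
have /andP[kl ku] := truncn_itv x0.
rewrite -/(k n t) in kl ku.
apply/andP; split.
  rewrite lerBlDr -addrA -[X in _ <= a + (_ + X)]mul1r -mulrDl natr1 -lerBlDl.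
  by rewrite ler_pdivlMr// ltW.
by rewrite -lerBrDl ler_pdivrMr.
Qed.

End StrongMeasurability.

(** * The Bochner integral *)
Lemma ereal_cvg0P (R : realType) (u : nat -> \bar R) : (forall n, 0 <= u n)%E ->
  u n @[n --> \oo] --> 0%E <->
  forall e : R, 0 < e -> exists N, forall n, (N <= n)%N -> (u n <= e%:E)%E.
Proof.
move=> u0; split.
  move=> /fine_cvgP[[N1 _ fN1] /cvgr0Pnorm_le cu] e e0.
  have [N2 _ hN2] := cu e e0; exists (maxn N1 N2) => n; rewrite geq_max => /andP[n1 n2].
  have fin := fN1 n n1; rewrite -(fineK fin) lee_fin.
  by apply: le_trans (hN2 n n2) => /=; exact: ler_norm.
move=> h; apply/fine_cvgP; split.
  have [N hN] := h 1 ltr01; exists N => // n /= Nn.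
  by rewrite ge0_fin_numE// (le_lt_trans (hN n Nn))// ltry.
apply/cvgr0Pnorm_le => e e0.
have [N hN] := h e e0; exists N => // n /= Nn.
have fin : u n \is a fin_num by rewrite ge0_fin_numE// (le_lt_trans (hN n Nn))// ltry.
by rewrite ger0_norm ?fine_ge0// -lee_fin fineK// hN.
Qed.

Section BochnerIntegral.
Context {R : realType} {E : completeNormedModType R}.
Local Notation mu := (@lebesgue_measure R).
Implicit Types (a b c : R) (f g s : R -> E) (I J : E).

Lemma simple_strongly_measurable a b s : simple_map s -> strongly_measurable a b s.
Proof.
by move=> ss; exists (fun=> s); split => //; apply: aeW => t _; exact: cvg_cst.
Qed.

Lemma norm_ae_measurable a b f : strongly_measurable a b f ->
  ae_measurable a b (fun t => `|f t|).
Proof. exact: (@strongly_measurable_norm _ _ _ _ _ id). Qed.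

Lemma integral_norm_ge0 a b f : (0 <= \int[mu]_(t in `]a, b[) `|f t|%:E)%E.
Proof. by apply: integral_ge0 => t _; rewrite lee_fin. Qed.

Lemma strongly_measurableB a b f g : strongly_measurable a b f ->
  strongly_measurable a b g -> strongly_measurable a b (fun t => f t - g t).
Proof.
move=> mf mg; have := strongly_measurableD mf (strongly_measurableZ (-1) mg).
by apply: strongly_measurable_ae; apply: aeW => t _; rewrite scaleN1r.
Qed.

Lemma integral_norm_triangle a b f g s : strongly_measurable a b f ->
  strongly_measurable a b g -> strongly_measurable a b s ->
  (\int[mu]_(t in `]a, b[) `|f t - g t|%:E <=
   \int[mu]_(t in `]a, b[) `|f t - s t|%:E +
   \int[mu]_(t in `]a, b[) `|s t - g t|%:E)%E.
Proof.
move=> mf mg ms; rewrite -ae_integralD//.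
- apply: ae_integral_le => [//|t|]; first by rewrite addr_ge0.
  by apply: aeW => t _; exact: ler_distD.
- by apply: norm_ae_measurable; exact: strongly_measurableB.
- by apply: norm_ae_measurable; exact: strongly_measurableB.
Qed.

Lemma integral_normC a b f g :
  (\int[mu]_(t in `]a, b[) `|f t - g t|%:E = \int[mu]_(t in `]a, b[) `|g t - f t|%:E)%E.
Proof. by apply: eq_integral => t _; rewrite distrC. Qed.

Lemma integral_norm_sub a b c d f : a <= c -> d <= b ->
  strongly_measurable a b f ->
  (\int[mu]_(t in `]c, d[) `|f t|%:E <= \int[mu]_(t in `]a, b[) `|f t|%:E)%E.
Proof.
move=> ac db mf; have [dc|cd] := leP d c.
  rewrite set_itv_ge ?integral_set0 ?integral_norm_ge0//.
  by rewrite bnd_simp -leNgt.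
have cb : c <= b by exact: le_trans (ltW cd) db.
have am := norm_ae_measurable mf.
rewrite (ae_integral_split ac cb)//.
rewrite (@ae_integral_split _ c b d (fun t => `|f t|) (ltW cd) db)//; last first.
  exact: ae_measurable_sub am.
rewrite addeCA leeDl// adde_ge0// integral_norm_ge0//.
Qed.

Lemma simple_integralD a b s r k : simple_map s -> simple_map r ->
  simple_integral a b (fun t => s t + k *: r t) =
  simple_integral a b s + k *: simple_integral a b r.
Proof.
move=> ss sr; have sh := simple_map_pair ss sr; have [fh _] := sh.
rewrite (simple_integral_comp a b sh (fun z : E * E => z.1 + k *: z.2)).
rewrite (simple_integral_comp a b sh (fun z : E * E => z.1)).
rewrite (simple_integral_comp a b sh (fun z : E * E => z.2)).
rewrite !fsbig_finite//= scaler_sumr -big_split/=; apply: eq_bigr => z _.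
by rewrite scalerDr !scalerA mulrC.
Qed.

Lemma simple_integral_norm a b s : simple_map s ->
  (`|simple_integral a b s|%:E <= \int[mu]_(t in `]a, b[) `|s t|%:E)%E.
Proof.
move=> ss; have [fs _] := ss.
rewrite (integral_simple_map a b ss (@normr_ge0 _ E)) lee_fin /simple_integral.
rewrite !fsbig_finite//=; apply: le_trans (ler_norm_sum _ _ _) _.
apply: ler_sum => x _; rewrite normrZ ger0_norm//.
by apply: fine_ge0; exact: measure_ge0.
Qed.

Lemma simple_integral_split a b c s : simple_map s -> a <= c -> c <= b ->
  simple_integral a b s = simple_integral a c s + simple_integral c b s.
Proof.
move=> [fs ms] ac cb; rewrite /simple_integral !fsbig_finite//= -big_split/=.
apply: eq_bigr => x _; rewrite -scalerDl; congr (_ *: _).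
have mx := ms x; set P := s @^-1` [set x] in mx *.
have muE d e : mu (`]d, e[ `&` P) = (\int[mu]_(t in `]d, e[) (\1_P t : R)%:E)%E.
  by rewrite integral_indic// setIC.
have fin d e : mu (`]d, e[ `&` P) \is a fin_num.
  by rewrite ge0_fin_numE//; exact: itv_measure_lty.
rewrite -fineD ?fin//; congr fine.
rewrite !muE (ae_integral_split ac cb)//.
exists (\1_P); split => //; exact: aeW.
Qed.

Lemma has_bochner_integral_measurable a b f I :
  has_bochner_integral a b f I -> strongly_measurable a b f.
Proof. by move=> [s [app _ _]]; exists s. Qed.

Lemma has_bochner_integral_approx a b f I : has_bochner_integral a b f I ->
  forall e, 0 < e -> exists s, [/\ simple_map s,
    (\int[mu]_(t in `]a, b[) `|f t - s t|%:E <= e%:E)%E &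
    `|simple_integral a b s - I| <= e].
Proof.
move=> [s [[ss _] cs ci]] e e0.
have /ereal_cvg0P/(_ _ e0)[|N1 h1] := cs; first by move=> n; exact: integral_norm_ge0.
have /cvgrPdist_le/(_ e e0)[N2 _ h2] := ci.
exists (s (maxn N1 N2)); split; [exact: ss|by apply: h1; exact: leq_maxl|].
by rewrite distrC; apply: h2 => /=; exact: leq_maxr.
Qed.

Lemma has_bochner_integral_simple a b s : simple_map s ->
  has_bochner_integral a b s (simple_integral a b s).
Proof.
move=> ss; exists (fun=> s); split.
- by split => //; apply: aeW => t _; exact: cvg_cst.
- apply/ereal_cvg0P => [n|e e0]; first exact: integral_norm_ge0.
  exists 0%N => n _; rewrite (eq_integral (cst 0%E)) ?integral0 ?lee_fin ?ltW//.
  by move=> t _; rewrite subrr normr0.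
- exact: cvg_cst.
Qed.

(** Uniqueness of the integral and the bound by the integral of the norm are both
    instances of this comparison. *)
Lemma has_bochner_integral_dist a b f g I J :
  has_bochner_integral a b f I -> has_bochner_integral a b g J ->
  (`|I - J|%:E <= \int[mu]_(t in `]a, b[) `|f t - g t|%:E)%E.
Proof.
move=> hf hg; apply/lee_addgt0Pr => e e0.
have e4 : 0 < e / 4 by rewrite divr_gt0.
have [s [ss fs sI]] := has_bochner_integral_approx hf e4.
have [r [sr gr rJ]] := has_bochner_integral_approx hg e4.
have mf := has_bochner_integral_measurable hf.
have mg := has_bochner_integral_measurable hg.
have ms := @simple_strongly_measurable a b s ss.
have mr := @simple_strongly_measurable a b r sr.
have key : (`|simple_integral a b s - simple_integral a b r|%:E <=
    \int[mu]_(t in `]a, b[) `|f t - g t|%:E + (e / 2)%:E)%E.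
  have -> : simple_integral a b s - simple_integral a b r =
      simple_integral a b (fun t => s t + (-1) *: r t).
    by rewrite simple_integralD// scaleN1r.
  apply: le_trans (simple_integral_norm _ _ _) _.
    exact: (simple_map_comp2 (fun x y => x + (-1) *: y) ss sr).
  under eq_integral do rewrite scaleN1r.
  apply: le_trans (integral_norm_triangle ms mr mf) _.
  apply: (@le_trans _ _ ((e / 4)%:E + (\int[mu]_(t in `]a, b[) `|f t - g t|%:E + (e / 4)%:E))%E).
    apply: leeD; first by rewrite integral_normC.
    apply: le_trans (integral_norm_triangle mf mr mg) _.
    by apply: leeD.
  rewrite addeCA -EFinD; apply: leeD => //; rewrite lee_fin; lra.
rewrite (_ : I - J = (I - simple_integral a b s) +
  ((simple_integral a b s - simple_integral a b r) + (simple_integral a b r - J))); last first.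
  by rewrite [X in _ = _ + X]subrKA subrKA.
apply: (@le_trans _ _ ((e / 4)%:E + (`|simple_integral a b s - simple_integral a b r|%:E + (e / 4)%:E))%E).
  rewrite -!EFinD lee_fin; apply: le_trans (ler_normD _ _) _; apply: lerD; first by rewrite distrC.
  by apply: le_trans (ler_normD _ _) _; apply: lerD.
rewrite addeCA -[X in (_ + X <= _)%E]EFinD.
have -> : e / 4 + e / 4 = e / 2 by lra.
apply: le_trans (leeD key (le_refl _)) _.
rewrite -addeA -EFinD; apply: leeD => //; rewrite lee_fin; lra.
Qed.

Lemma has_bochner_integral_unique a b f I J :
  has_bochner_integral a b f I -> has_bochner_integral a b f J -> I = J.
Proof.
move=> hI hJ; have := has_bochner_integral_dist hI hJ.
rewrite (eq_integral (cst 0%E)); last by move=> t _; rewrite subrr normr0.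
by rewrite integral0 lee_fin normr_le0 subr_eq0 => /eqP.
Qed.

Lemma has_bochner_integral_cst a b (x : E) : a <= b ->
  has_bochner_integral a b (cst x) ((b - a) *: x).
Proof.
move=> ab; have sx := simple_map_cst (R := R) x.
have := has_bochner_integral_simple a b sx.
suff -> : simple_integral a b (cst x) = (b - a) *: x by [].
have st := simple_map_cst (R := R) tt.
rewrite (simple_integral_comp a b st (fun=> x)).
have -> : range (fun _ : R => tt) = [set tt].
  by apply/seteqP; split => [[]//|[] _]; exists 0.
rewrite fsbig_set1; congr (_ *: _).
have -> : (fun=> tt) @^-1` [set tt] = setT :> set R by apply/seteqP; split.
rewrite setIT; have := integral_cst_itv 1 ab.
rewrite mul1r integral_cst//= mul1e => ->//.
Qed.

Lemma has_bochner_integral_norm a b f I : a <= b -> has_bochner_integral a b f I ->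
  (`|I|%:E <= \int[mu]_(t in `]a, b[) `|f t|%:E)%E.
Proof.
move=> ab hI; have := has_bochner_integral_dist hI (has_bochner_integral_cst 0 ab).
by rewrite scaler0 subr0; under eq_integral do rewrite subr0.
Qed.

Lemma has_bochner_integralD a b f g I J k :
  has_bochner_integral a b f I -> has_bochner_integral a b g J ->
  has_bochner_integral a b (fun t => f t + k *: g t) (I + k *: J).
Proof.
move=> hf hg; have mf := has_bochner_integral_measurable hf.
have mg := has_bochner_integral_measurable hg.
move: hf hg => [s [[ss cs] is_ ci]] [r [[sr cr] ir cj]].
exists (fun n t => s n t + k *: r n t); split.
- split; first by move=> n; exact: (simple_map_comp2 (fun x y => x + k *: y) (ss n) (sr n)).
  apply: filterS2 cs cr => t st rt tab; apply: cvgD; first exact: st.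
  by apply: cvgZr; exact: rt.
- have k1 : 0 < 1 + `|k| by rewrite ltr_pwDl.
  apply/ereal_cvg0P => [n|e e0]; first exact: integral_norm_ge0.
  have e1 : 0 < e / 2 by rewrite divr_gt0.
  have e2 : 0 < e / 2 / (1 + `|k|) by rewrite !divr_gt0.
  have /ereal_cvg0P/(_ _ e1)[|N1 h1] := is_; first by move=> n; exact: integral_norm_ge0.
  have /ereal_cvg0P/(_ _ e2)[|N2 h2] := ir; first by move=> n; exact: integral_norm_ge0.
  exists (maxn N1 N2) => n; rewrite geq_max => /andP[n1 n2].
  have ms : ae_measurable a b (fun t => `|f t - s n t|).
    apply: norm_ae_measurable; apply: strongly_measurableB => //.
    exact: (simple_strongly_measurable _ _ (ss n)).
  have mr : ae_measurable a b (fun t => `|g t - r n t|).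
    apply: norm_ae_measurable; apply: strongly_measurableB => //.
    exact: (simple_strongly_measurable _ _ (sr n)).
  apply: (@le_trans _ _ (\int[mu]_(t in `]a, b[) (`|f t - s n t| + (1 + `|k|) * `|g t - r n t|)%:E)%E).
    apply: ae_integral_le => [//|t|]; first by rewrite addr_ge0// mulr_ge0// ltW.
    apply: aeW => t _.
    have -> : f t + k *: g t - (s n t + k *: r n t) = (f t - s n t) + k *: (g t - r n t).
      by rewrite scalerBr opprD addrACA.
    apply: le_trans (ler_normD _ _) _; rewrite lerD2l normrZ ler_wpM2r//.
    by rewrite lerDr.
  have pos t : 0 <= (1 + `|k|) * `|g t - r n t| by rewrite mulr_ge0// ltW.
  rewrite (ae_integralD (fun t => normr_ge0 _) pos ms (ae_measurableZ (ltW k1) mr)).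
  rewrite (ae_integralZ (ltW k1) (fun t => normr_ge0 _) mr).
  have -> : e = e / 2 + e / 2 by lra.
  rewrite [leRHS]EFinD; apply: leeD; first exact: h1.
  have -> : e / 2 = (1 + `|k|) * (e / 2 / (1 + `|k|)).
    by rewrite [RHS]mulrC divfK// gt_eqF.
  by rewrite EFinM; apply: lee_wpmul2l; [rewrite lee_fin ltW|exact: h2].
- have -> : (fun n => simple_integral a b (fun t => s n t + k *: r n t)) =
      (fun n => simple_integral a b (s n) + k *: simple_integral a b (r n)).
    by apply/funext => n; exact: (simple_integralD _ _ k (ss n) (sr n)).
  by apply: cvgD => //; apply: cvgZr.
Qed.

(** Approximations on (a, b) are approximations on (a, c) as well, where the
    limit of their integrals is already known. *)
Lemma has_bochner_integral_subinterval a b c f I J : a <= c -> c <= b ->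
  has_bochner_integral a b f J -> has_bochner_integral a c f I ->
  has_bochner_integral c b f (J - I).
Proof.
move=> ac cb hJ hI; have mf := has_bochner_integral_measurable hJ.
move: hJ => [s [[ss cs] is_ ci]].
have small u v : a <= u -> v <= b ->
    (\int[mu]_(t in `]u, v[) `|f t - s n t|%:E)%E @[n --> \oo] --> 0%E.
  move=> au vb; apply/ereal_cvg0P => [n|e e0]; first exact: integral_norm_ge0.
  have /ereal_cvg0P/(_ _ e0)[|N h] := is_; first by move=> n; exact: integral_norm_ge0.
  exists N => n Nn; apply: le_trans (h n Nn); apply: (integral_norm_sub au vb).
  exact: (strongly_measurableB mf (simple_strongly_measurable _ _ (ss n))).
exists s; split; [split => //|exact: small|].
  by apply: ae_subinterval cs.
have -> : (fun n => simple_integral c b (s n)) =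
    (fun n => simple_integral a b (s n) - simple_integral a c (s n)).
  by apply/funext => n; rewrite (simple_integral_split (ss n) ac cb) addrC addKr.
apply: cvgB => //; apply/cvgrPdist_le => e e0.
have /ereal_cvg0P/(_ _ e0)[|N h] := small a c (lexx _) cb.
  by move=> n; exact: integral_norm_ge0.
exists N => // n /= Nn; rewrite -lee_fin; apply: le_trans (h n Nn).
exact: has_bochner_integral_dist (has_bochner_integral_simple _ _ (ss n)).
Qed.

(** Approximations dominated by a multiple of the norm converge in L^1, so their
    integrals form a Cauchy sequence. *)
Lemma has_bochner_integral_exists a b f : strongly_measurable a b f ->
  (\int[mu]_(t in `]a, b[) `|f t|%:E < +oo)%E -> exists I, has_bochner_integral a b f I.
Proof.
move=> mf fin; have [h [mh h0 fh]] := norm_ae_measurable mf.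
have [s [ss cs]] := mf.
(* Truncating where the approximation is twice too large keeps it simple,
   keeps its pointwise limit, and makes the error dominated by 3 h. *)
pose A n := [set t | `|s n t| <= 2 * h t].
have mA n : measurable (A n).
  have m2h : measurable_fun setT (fun t => 2 * h t) by exact: measurable_funM.
  have /(_ measurableT [set true]) := measurable_fun_ler
    (simple_map_measurable (Num.norm : E -> R) (ss n)) m2h.
  rewrite setTI; apply => //.
pose r n t := if t \in A n then s n t else 0.
have sr n : simple_map (r n) 
  by apply: simple_map_if; [exact: mA|exact: ss|exact: simple_map_cst].
have rle n t : `|r n t| <= 2 * h t.
  by rewrite /r; case: ifPn => [/set_mem//|_]; rewrite normr0 mulr_ge0.
have cr : {ae mu, forall t, t \in `]a, b[ -> r n t @[n --> \oo] --> f t}.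
  apply: filterS2 cs fh => t cst fht tab; have {}cst := cst tab; have {}fht := fht tab.
  have [ft0|ft0] := eqVneq (f t) 0.
    have r0 n : r n t = 0.
      by apply/eqP; rewrite -normr_le0 (le_trans (rle n t))// -fht ft0 normr0 mulr0.
    by under eq_fun do rewrite r0; rewrite ft0; exact: cvg_cst.
  apply: (cvg_trans _ cst); apply: near_eq_cvg.
  have ltf : `|f t| < 2 * `|f t| by rewrite mulr_natl mulr2n ltrDr normr_gt0.
  have near_lt : \forall n \near \oo, `|s n t| < 2 * `|f t|.
    exact: (cvgr_lt _ (cvg_norm cst) _ ltf).
  apply: filterS near_lt => n /ltW sn; rewrite /r ifT//.
  by apply/mem_set; rewrite /A /= -fht.
have mr n : strongly_measurable a b (fun t => f t - r n t).
  exact: (strongly_measurableB mf (simple_strongly_measurable _ _ (sr n))).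
have small : (\int[mu]_(t in `]a, b[) `|f t - r n t|%:E)%E @[n --> \oo] --> 0%E.
  have /choice[K hK] : forall n, exists K : R -> R, [/\ measurable_fun setT K,
      forall t, 0 <= K t & {ae mu, forall t, t \in `]a, b[ -> `|f t - r n t| = K t}].
    by move=> n; exact: (norm_ae_measurable (mr n)).
  have -> : (fun n => \int[mu]_(t in `]a, b[) `|f t - r n t|%:E)%E =
      (fun n => \int[mu]_(t in `]a, b[) (K n t)%:E)%E.
    by apply/funext => n; have [_ K0 KE] := hK n; exact: ae_integralE.
  have aeK : {ae mu, forall t n, t \in `]a, b[ -> `|f t - r n t| = K n t}.
    by apply: ae_foralln => n; have [] := hK n.
  have ih : mu.-integrable `]a, b[%classic (fun t => (3 * h t)%:E).
    apply/integrableP; split.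
      by apply/measurable_EFinP; apply: measurable_funM => //; exact: measurable_funTS.
    under eq_integral do rewrite gee0_abs ?lee_fin ?mulr_ge0//.
    rewrite ae_integralZ//; last by exists h; split => //; exact: aeW.
    rewrite -(ae_integralE (fun t => normr_ge0 (f t)) h0 fh).
    by rewrite lte_mul_pinfty.
  have mK n : measurable_fun `]a, b[%classic (fun t => (K n t)%:E).
    by apply/measurable_EFinP; apply: measurable_funTS; have [] := hK n.
  have m0 : measurable_fun `]a, b[%classic (fun=> 0 : \bar R) by exact: measurable_cst.
  have [||_ _] := @dominated_convergence _ _ _ mu _ (measurable_itv _) _ _ _ mK m0 _ ih.
  - apply: filterS2 cr aeK => t ct Kt tab.
    have -> : (fun n => (K n t)%:E) = (fun n => `|f t - r n t|%:E).
      by apply/funext => n; rewrite Kt.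
    apply: cvg_EFin; first exact: nearW.
    rewrite -(normr0 E) -(subrr (f t)); apply: cvg_norm.
    by apply: cvgB; [exact: cvg_cst|exact: ct].
  - apply: filterS2 aeK fh => t Kt fht n tab.
    have [_ K0 _] := hK n.
    rewrite gee0_abs ?lee_fin// -Kt//.
    apply: le_trans (ler_normB _ _) _; rewrite fht//.
    by have := rle n t; lra.
  by rewrite integral0.
have cau : cauchy (simple_integral a b (r n) @[n --> \oo]).
  apply/cauchy_exP => e e0; have e3 : 0 < e / 3 by rewrite divr_gt0.
  have /ereal_cvg0P/(_ _ e3)[|N hN] := small; first by move=> n; exact: integral_norm_ge0.
  exists (simple_integral a b (r N)); exists N => // n /= Nn.
  rewrite -ball_normE /ball_ /= -lte_fin.
  have hb k := has_bochner_integral_simple a b (sr k).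
  apply: le_lt_trans (has_bochner_integral_dist (hb N) (hb n)) _.
  have sm k := simple_strongly_measurable a b (sr k).
  apply: le_lt_trans (integral_norm_triangle (sm N) (sm n) mf) _.
  rewrite integral_normC; apply: le_lt_trans (leeD (hN N (leqnn _)) (hN n Nn)) _.
  rewrite -EFinD lte_fin; lra.
have /cvg_ex[I cI] : cvg (simple_integral a b (r n) @[n --> \oo]) by apply/cauchy_cvgP.
by exists I; exists r; split.
Qed.

End BochnerIntegral.

(** * Translations *)
Section Translation.
Context {R : realType}.
Local Notation mu := (@lebesgue_measure R).
Implicit Types (a b h : R).

Lemma translation_measurable h : measurable_fun [set: R] (fun t : R => t - h).
Proof. exact: measurable_funB. Qed.

Lemma lebesgue_measure_translation h (A : set R) : measurable A ->
  mu ((fun t => t - h) @^-1` A) = mu A.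
Proof.
have mphi : @measurable_fun _ _ (measurableTypeR R) (measurableTypeR R)
    setT (fun t => t - h) by exact: translation_measurable.
pose phi : {mfun measurableTypeR R >-> measurableTypeR R} :=
  HB.pack (fun t : measurableTypeR R => t - h : measurableTypeR R)
    (@isMeasurableFun.Build _ _ (measurableTypeR R) (measurableTypeR R) _ mphi).
move=> mA; apply/esym; apply: (@lebesgue_measure_unique R (pushforward mu phi)) => //= _ [[a b]] _ <-.
rewrite /pushforward/=.
have -> : (fun t => t - h) @^-1` `]a, b]%classic = `]a + h, b + h]%classic.
  by apply/seteqP; split => t /=; rewrite !in_itv/= ltrBrDr lerBlDr.
rewrite !lebesgue_measure_itv/= !lte_fin ltrD2r; case: ifP => // _.
by rewrite -!EFinD; congr EFin; lra.
Qed.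

Lemma preimage_translation_itv a b h :
  (fun t => t - h) @^-1` `]a, b[%classic = `]a + h, b + h[%classic.
Proof. by apply/seteqP; split => t /=; rewrite !in_itv/= ltrBrDr ltrBlDr. Qed.

Lemma mem_translation_itv a b h t : t \in `]a + h, b + h[ -> t - h \in `]a, b[.
Proof. by rewrite !in_itv/= ltrBrDr ltrBlDr. Qed.

Lemma ae_translation h (P : R -> Prop) :
  {ae mu, forall t, P t} -> {ae mu, forall t, P (t - h)}.
Proof.
move=> [N [mN N0 sub]]; exists ((fun t => t - h) @^-1` N); split.
- by rewrite -[X in measurable X]setTI; exact: translation_measurable.
- by rewrite lebesgue_measure_translation.
- by move=> t /= nP; apply: sub.
Qed.

Lemma ae_translation_itv a b h (P : R -> Prop) :
  {ae mu, forall t, t \in `]a, b[ -> P t} ->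
  {ae mu, forall t, t \in `]a + h, b + h[ -> P (t - h)}.
Proof. by move=> /(ae_translation h); apply: filterS => t Pt /mem_translation_itv. Qed.

Lemma integral_translation a b h (H : R -> R) : (forall t, 0 <= H t) ->
  ae_measurable a b H ->
  (\int[mu]_(t in `](a + h)%R, (b + h)%R[) (H (t - h)%R)%:E = \int[mu]_(t in `]a, b[) (H t)%:E)%E.
Proof.
move=> H0 [k [mk k0 Hk]].
rewrite (ae_integralE H0 k0 Hk).
rewrite (ae_integralE (fun t => H0 _) (fun t => k0 (t - h)) (ae_translation_itv h Hk)).
rewrite -preimage_translation_itv.
have mk' : measurable_fun `]a, b[%classic (EFin \o k).
  by apply/measurable_EFinP; exact: measurable_funTS.
have := @ge0_integral_pushforward _ _ (measurableTypeR R) (measurableTypeR R) R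
  _ (translation_measurable h) mu _ _ (measurable_itv _) mk'.
move=> <-; last by move=> t _; rewrite lee_fin.
apply: eq_measure_integral; first exact: translation_measurable.
by move=> mphi A mA _; exact: (lebesgue_measure_translation h mA).
Qed.

Lemma simple_map_translation T h (s : R -> T) :
  simple_map s -> simple_map (fun t => s (t - h)).
Proof.
move=> [fs ms]; split.
  by apply: (sub_finite_set _ fs) => _ [t _ <-]; exists (t - h).
move=> z; rewrite -[X in measurable X]setTI.
exact: (translation_measurable h measurableT (ms z)).
Qed.

Context {E : completeNormedModType R}.
Implicit Types (f s : R -> E) (I : E).

Lemma simple_integral_translation a b h s : simple_map s ->
  simple_integral (a + h) (b + h) (fun t => s (t - h)) = simple_integral a b s.
Proof.
move=> [fs ms]; rewrite /simple_integral.
have -> : range (fun t => s (t - h)) = range s.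
  apply/seteqP; split => [_ [t _ <-]|_ [t _ <-]]; first by exists (t - h).
  by exists (t + h) => //; rewrite addrK.
apply: eq_fsbigr => x _; congr (fine _ *: _).
rewrite -preimage_translation_itv.
rewrite -[RHS](lebesgue_measure_translation h)//; apply: measurableI => //; exact: ms.
Qed.

Lemma strongly_measurable_translation a b h f : strongly_measurable a b f ->
  strongly_measurable (a + h) (b + h) (fun t => f (t - h)).
Proof.
move=> [s [ss cs]]; exists (fun n t => s n (t - h)); split.
  by move=> n; apply: simple_map_translation; exact: ss.
exact: (ae_translation_itv h cs).
Qed.

Lemma has_bochner_integral_translation a b h f I : has_bochner_integral a b f I ->
  has_bochner_integral (a + h) (b + h) (fun t => f (t - h)) I.
Proof.
move=> hI; have mf := has_bochner_integral_measurable hI.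
move: hI => [s [[ss cs] is_ ci]]; exists (fun n t => s n (t - h)); split.
- split; last exact: (ae_translation_itv h cs).
  by move=> n; apply: simple_map_translation; exact: ss.
- apply: cvg_trans is_; apply: near_eq_cvg; apply: nearW => n.
  apply/esym; apply: (integral_translation h (fun t => normr_ge0 (f t - s n t))).
  apply: norm_ae_measurable; apply: strongly_measurableB => //.
  exact: (simple_strongly_measurable _ _ (ss n)).
- apply: cvg_trans ci; apply: near_eq_cvg; apply: nearW => n.
  by apply/esym; apply: simple_integral_translation; exact: ss.
Qed.

End Translation.

(** * The integral of a power of the norm *)
Section PowerIntegrals.
Context {R : realType}.
Local Notation mu := (@lebesgue_measure R).
Context {E : completeNormedModType R}.
Implicit Types (a b c d p : R) (f g : R -> E).

(** The p-th power of the norm of L^p(a, b; E). *)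
Definition power_integral p a b f : \bar R :=
  (\int[mu]_(t in `]a, b[) (`|f t| `^ p)%:E)%E.

Lemma power_integral_ge0 p a b f : (0 <= power_integral p a b f)%E.
Proof. by apply: integral_ge0 => t _; rewrite lee_fin powR_ge0. Qed.

Lemma power_ae_measurable p a b f : strongly_measurable a b f ->
  ae_measurable a b (fun t => `|f t| `^ p).
Proof.
apply: (@strongly_measurable_norm _ _ _ _ _ (fun x => x `^ p)).
  exact: measurable_powR.
by move=> x _; exact: powR_ge0.
Qed.

Lemma power_integral_fin p a b f : in_Lq p a b f ->
  exists2 r, 0 <= r & power_integral p a b f = r%:E.
Proof. by move=> [_ fin]; apply: integral_lty_fin fin => t; exact: powR_ge0. Qed.

Lemma in_Lq_fin p a b f r : strongly_measurable a b f ->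
  (power_integral p a b f <= r%:E)%E -> in_Lq p a b f.
Proof. by move=> mf fr; split => //; apply: le_lt_trans fr _; rewrite ltry. Qed.

Lemma power_integral_ae p a b f g :
  {ae mu, forall t, t \in `]a, b[ -> `|f t| = `|g t|} ->
  power_integral p a b f = power_integral p a b g.
Proof.
move=> fg; apply: ae_integralE; [by move=> t; exact: powR_ge0|
  by move=> t; exact: powR_ge0|].
by apply: filterS fg => t e tab; rewrite e.
Qed.

Lemma power_integral_empty p a b f : b <= a -> power_integral p a b f = 0%E.
Proof.
by move=> ba; rewrite /power_integral set_itv_ge ?integral_set0// bnd_simp -leNgt.
Qed.

Lemma power_integral_split p a b c f : a <= c -> c <= b -> strongly_measurable a b f ->
  (power_integral p a b f = power_integral p a c f + power_integral p c b f)%E.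
Proof.
move=> ac cb mf; apply: (ae_integral_split ac cb); first by move=> t; exact: powR_ge0.
exact: power_ae_measurable.
Qed.

Lemma power_integral_sub p a b c d f : a <= c -> d <= b ->
  (power_integral p c d f <= power_integral p a b f)%E.
Proof.
move=> ac db; rewrite /power_integral [leLHS]integral_mkcond [leRHS]integral_mkcond.
have pos u v t : (0 <= ((fun t => (`|f t| `^ p)%:E) \_ `]u, v[) t)%E.
  by apply: erestrict_ge0 => r _; rewrite lee_fin powR_ge0.
apply: ae_le_integral => //; apply: aeW => t _.
have [tcd|tcd] := boolP (t \in `]c, d[%classic); last by rewrite {1}/patch (negbTE tcd) pos.
have tab : t \in `]a, b[%classic.
  move/set_mem : tcd => /=; rewrite in_itv/= => /andP[ct td]; apply/mem_set => /=.
  by rewrite in_itv/= (le_lt_trans ac ct) (lt_le_trans td db).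
by rewrite !patchE tcd tab.
Qed.

Lemma power_integralZ p a b k f : 0 <= p -> strongly_measurable a b f ->
  (power_integral p a b (fun t => k *: f t) = (`|k| `^ p)%:E * power_integral p a b f)%E.
Proof.
move=> p0 mf; rewrite /power_integral -ae_integralZ.
- by apply: eq_integral => t _; rewrite normrZ powRM.
- exact: powR_ge0.
- by move=> t; exact: powR_ge0.
- exact: power_ae_measurable.
Qed.

Lemma powR_addr_le (x y p : R) : 0 <= p -> 0 <= x -> 0 <= y ->
  (x + y) `^ p <= 2 `^ p * (x `^ p + y `^ p).
Proof.
move=> p0 x0 y0.
wlog xy : x y x0 y0 / x <= y.
  by move=> hw; case: (leP x y) => [|/ltW] xy; [|rewrite addrC [x `^ _ + _]addrC]; exact: hw.
apply: (@le_trans _ _ ((2 * y) `^ p)).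
  by apply: ge0_ler_powR; rewrite ?nnegrE ?addr_ge0 ?mulr_ge0//; lra.
by rewrite powRM// ler_pM2l ?powR_gt0// lerDr powR_ge0.
Qed.

End PowerIntegrals.

Section PowerIntegralComparison.
Context {R : realType}.
Local Notation mu := (@lebesgue_measure R).
Implicit Types (a b c d p : R).

Lemma power_integral_le (E F : completeNormedModType R) p a b (f : R -> E) (g : R -> F) :
  0 <= p -> {ae mu, forall t, t \in `]a, b[ -> `|f t| <= `|g t|} ->
  (power_integral p a b f <= power_integral p a b g)%E.
Proof.
move=> p0 fg; apply: ae_integral_le; [by move=> t; exact: powR_ge0|
  by move=> t; exact: powR_ge0|].
by apply: filterS fg => t e tab; apply: ge0_ler_powR; rewrite ?nnegrE// e.
Qed.

Lemma power_integral_leD (E F G : completeNormedModType R) p a b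
    (f : R -> E) (g : R -> F) (h : R -> G) : 0 <= p ->
  strongly_measurable a b g -> strongly_measurable a b h ->
  {ae mu, forall t, t \in `]a, b[ -> `|f t| <= `|g t| + `|h t|} ->
  (power_integral p a b f <=
   (2 `^ p)%:E * (power_integral p a b g + power_integral p a b h))%E.
Proof.
move=> p0 mg mh fgh.
have pos (x : R) : 0 <= x `^ p by exact: powR_ge0.
rewrite /power_integral -ae_integralD; [|by []|by []|exact: power_ae_measurable|exact: power_ae_measurable].
rewrite -ae_integralZ; [|by []|by move=> t; rewrite addr_ge0|]; last first.
  by apply: ae_measurableD; exact: power_ae_measurable.
apply: ae_integral_le => [//|t|]; first by rewrite mulr_ge0// addr_ge0.
apply: filterS fgh => t le tab; apply: le_trans (powR_addr_le _ _ _) => //.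
by apply: ge0_ler_powR; rewrite ?nnegrE ?addr_ge0// le.
Qed.

Lemma power_integral_bound (E : completeNormedModType R) p a b (f : R -> E) m :
  a <= b -> 0 <= p -> 0 <= m -> (forall t, t \in `]a, b[ -> `|f t| <= m) ->
  (power_integral p a b f <= (m `^ p * (b - a))%:E)%E.
Proof.
move=> ab p0 m0 fm; rewrite -integral_cst_itv//.
apply: ae_integral_le; [by move=> t; exact: powR_ge0|by move=> t; exact: powR_ge0|].
by apply: aeW => t tab; apply: ge0_ler_powR; rewrite ?nnegrE// fm.
Qed.

Lemma power_integral_translation (E : completeNormedModType R) p a b h (f : R -> E) :
  strongly_measurable a b f ->
  power_integral p (a + h) (b + h) (fun t => f (t - h)) = power_integral p a b f.
Proof.
move=> mf; apply: (integral_translation h (fun t => powR_ge0 `|f t| p)).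
exact: power_ae_measurable.
Qed.

Context {E : completeNormedModType R}.
Implicit Types (f g : R -> E).

Lemma in_Lq_sub p a b c d f : a <= c -> d <= b -> in_Lq p a b f -> in_Lq p c d f.
Proof.
move=> ac db [mf fin]; split; first exact: strongly_measurable_sub mf.
exact: le_lt_trans (power_integral_sub p f ac db) fin.
Qed.

Lemma in_Lq_le (F : completeNormedModType R) p a b (f : R -> E) (g : R -> F) k :
  0 <= p -> 0 <= k -> strongly_measurable a b f -> in_Lq p a b g ->
  {ae mu, forall t, t \in `]a, b[ -> `|f t| <= k * `|g t|} -> in_Lq p a b f.
Proof.
move=> p0 k0 mf gL fg; have [r r0 gr] := power_integral_fin gL.
apply: (in_Lq_fin (r := k `^ p * r)) => //.
apply: (@le_trans _ _ (power_integral p a b (fun t => k *: g t))).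
  apply: power_integral_le => //; apply: filterS fg => t le tab.
  by rewrite normrZ (ger0_norm k0) le.
by rewrite power_integralZ ?gr ?(ger0_norm k0)//; case: gL.
Qed.

Lemma in_LqD p a b f g : 0 <= p -> in_Lq p a b f -> in_Lq p a b g ->
  in_Lq p a b (fun t => f t + g t).
Proof.
move=> p0 fL gL; have [r r0 fr] := power_integral_fin fL.
have [q q0 gq] := power_integral_fin gL; have [mf _] := fL; have [mg _] := gL.
apply: (in_Lq_fin (r := 2 `^ p * (r + q))); first exact: strongly_measurableD.
rewrite EFinM EFinD -fr -gq; apply: power_integral_leD => //.
by apply: aeW => t _; exact: ler_normD.
Qed.

Lemma in_LqZ p a b k f : 0 <= p -> in_Lq p a b f -> in_Lq p a b (fun t => k *: f t).
Proof.
move=> p0 fL; have [mf _] := fL; apply: (in_Lq_le (k := `|k|) p0 _ _ fL) => //.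
  exact: strongly_measurableZ.
by apply: aeW => t _; rewrite normrZ.
Qed.

Lemma in_Lq_bounded p a b f m : 0 <= p -> 0 <= m -> strongly_measurable a b f ->
  (forall t, t \in `]a, b[ -> `|f t| <= m) -> in_Lq p a b f.
Proof.
move=> p0 m0 mf fm; have [ba|ab] := leP b a.
  apply: (in_Lq_fin (r := 0)) => //; rewrite power_integral_empty//.
exact: (in_Lq_fin mf (power_integral_bound (ltW ab) p0 m0 fm)).
Qed.

Lemma in_Lq_cst p a b (x : E) : 0 <= p -> in_Lq p a b (cst x).
Proof.
move=> p0; apply: (in_Lq_bounded (m := `|x|)) => //; exact: strongly_measurable_cst.
Qed.

Lemma in_Lq_translation p a b h f : in_Lq p a b f ->
  in_Lq p (a + h) (b + h) (fun t => f (t - h)).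
Proof.
move=> [mf fin]; split; first exact: strongly_measurable_translation.
by have := power_integral_translation p h mf; rewrite /power_integral => ->.
Qed.

Lemma in_Lq_scale p a b m (k : R -> R) f : 0 <= p -> 0 <= m ->
  strongly_measurable a b (k : R -> R^o) ->
  (forall t, t \in `]a, b[ -> `|k t| <= m) ->
  in_Lq p a b f -> in_Lq p a b (fun t => k t *: f t).
Proof.
move=> p0 m0 mk km fL; have [mf _] := fL; apply: (in_Lq_le p0 m0 _ fL).
  exact: strongly_measurable_scale.
by apply: aeW => t tab; rewrite normrZ ler_wpM2r// km.
Qed.

(** On a bounded interval L^p is contained in L^1, since x <= 1 + x^p. *)
Lemma in_Lq_integrable p a b f : 1 <= p -> in_Lq p a b f ->
  (\int[mu]_(t in `]a, b[) `|f t|%:E < +oo)%E.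
Proof.
move=> p1 fL; have [r r0 fr] := power_integral_fin fL; have [mf _] := fL.
have [ba|ab] := leP b a.
  by rewrite set_itv_ge ?integral_set0// bnd_simp -leNgt.
apply: (@le_lt_trans _ _ (\int[mu]_(t in `]a, b[) (1 + `|f t| `^ p)%:E)%E).
  apply: ae_integral_le => [//|t|]; first by rewrite addr_ge0// powR_ge0.
  apply: aeW => t _; have [x1|x1] := leP `|f t| 1; first by rewrite ler_wpDr// powR_ge0.
  rewrite ler_wpDl//; rewrite -[leLHS]powRr1//.
  by apply: ler_powR => //; exact: ltW.
rewrite (ae_integralD (fun=> ler01) (fun t => powR_ge0 _ _)
  (ae_measurable_cst _ _ ler01) (power_ae_measurable p mf)).
rewrite integral_cst_itv ?ltW// -/(power_integral p a b f) fr -EFinD ltry//.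
Qed.

Lemma in_Lq_has_bochner_integral p a b f : 1 <= p -> in_Lq p a b f ->
  exists I, has_bochner_integral a b f I.
Proof.
move=> p1 fL; apply: has_bochner_integral_exists; first by case: fL.
exact: in_Lq_integrable fL.
Qed.

End PowerIntegralComparison.

(** * Sobolev functions in time and the product rule *)
Section SobolevFunctions.
Context {R : realType} {E : completeNormedModType R}.
Local Notation mu := (@lebesgue_measure R).
Implicit Types (a b c d h q : R) (u g : R -> E).

Lemma W1q_derivativeD q a b u1 g1 u2 g2 k : 0 <= q ->
  W1q_derivative q a b u1 g1 -> W1q_derivative q a b u2 g2 ->
  W1q_derivative q a b (fun t => u1 t + k *: u2 t) (fun t => g1 t + k *: g2 t).
Proof.
move=> q0 [u1L g1L h1] [u2L g2L h2]; split.
- exact: (in_LqD q0 u1L (in_LqZ k q0 u2L)).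
- exact: (in_LqD q0 g1L (in_LqZ k q0 g2L)).
move=> t tab; have := has_bochner_integralD k (h1 t tab) (h2 t tab).
by rewrite scalerBr addrACA -opprD.
Qed.

Lemma has_bochner_integral_W1q q a b x y u g : W1q_derivative q a b u g ->
  a <= x -> x <= y -> y <= b -> has_bochner_integral x y g (u y - u x).
Proof.
move=> [_ _ hu] ax xy yb.
have hy : y \in `[a, b] by rewrite in_itv/= (le_trans ax xy).
have hx : x \in `[a, b] by rewrite in_itv/= ax (le_trans xy yb).
have := has_bochner_integral_subinterval ax xy (hu y hy) (hu x hx).
by rewrite opprB addrA subrK.
Qed.

Lemma W1q_derivative_sub q a b c d u g : a <= c -> c <= d -> d <= b ->
  W1q_derivative q a b u g -> W1q_derivative q c d u g.
Proof.
move=> ac cd db W; have [uL gL _] := W; split.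
- exact: in_Lq_sub uL.
- exact: in_Lq_sub gL.
move=> t; rewrite in_itv/= => /andP[ct td].
by apply: (has_bochner_integral_W1q W) => //; exact: le_trans td db.
Qed.

Lemma W1q_derivative_translation q a b h u g : W1q_derivative q a b u g ->
  W1q_derivative q (a + h) (b + h) (fun t => u (t - h)) (fun t => g (t - h)).
Proof.
move=> [uL gL hu]; split; [exact: (in_Lq_translation h uL)|exact: (in_Lq_translation h gL)|].
move=> t; rewrite in_itv/= => /andP[at_ tb].
have th : t - h \in `[a, b] by rewrite in_itv/= lerBrDr at_ lerBlDr.
by have := has_bochner_integral_translation h (hu _ th); rewrite subrK addrK.
Qed.

Lemma W1q_derivative_cst q a b (x : E) : 0 <= q ->
  W1q_derivative q a b (cst x) (cst 0).
Proof.
move=> q0; split; [exact: in_Lq_cst|exact: in_Lq_cst|].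
move=> t; rewrite in_itv/= => /andP[at_ _].
by have := has_bochner_integral_cst (0 : E) at_; rewrite scaler0 subrr.
Qed.

(** The bound on short increments is summed over a subdivision of [a, b] into
    pieces shorter than e. *)
Lemma increments_telescope a b e (F : R -> E) (G : R -> R) : a <= b -> 0 < e ->
  (forall x y, a <= x -> x <= y -> y <= b -> y - x <= e ->
     `|F y - F x| <= G y - G x) -> `|F b - F a| <= G b - G a.
Proof.
move=> ab e0 FG; pose n := Num.truncn ((b - a) / e).
have n0 : 0 < n.+1%:R :> R by rewrite ltr0n.
have small : (b - a) / n.+1%:R <= e.
  by rewrite ler_pdivrMr// mulrC -ler_pdivrMr//; apply/ltW/truncnS_gt.
pose x i : R := a + (b - a) * (i%:R / n.+1%:R).
have xS i : x i.+1 - x i = (b - a) / n.+1%:R.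
  by rewrite /x opprD addrACA subrr add0r -mulrBr -mulrBl -natr1 addrAC subrr add0r mul1r.
have x0 : x 0%N = a by rewrite /x mul0r mulr0 addr0.
have xn : x n.+1 = b by rewrite /x divff ?gt_eqF// mulr1 addrC subrK.
have xa i : a <= x i by rewrite lerDl mulr_ge0 ?subr_ge0// divr_ge0// ltW.
have xx i : x i <= x i.+1 by rewrite -subr_ge0 xS divr_ge0 ?subr_ge0// ltW.
have xb i : (i <= n.+1)%N -> x i <= b.
  move=> iN; rewrite -[leRHS]xn /x lerD2l ler_wpM2l ?subr_ge0//.
  by rewrite ler_wpM2r ?ler_nat// invr_ge0 ltW.
have step i : (i <= n.+1)%N -> `|F (x i) - F a| <= G (x i) - G a.
  elim: i => [_|i IH iN]; first by rewrite x0 !subrr normr0.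
  have h1 : `|F (x i.+1) - F (x i)| <= G (x i.+1) - G (x i).
    by apply: FG; rewrite ?xS//; exact: xb.
  have h2 := IH (ltnW iN).
  have -> : F (x i.+1) - F a = (F (x i.+1) - F (x i)) + (F (x i) - F a).
    by rewrite addrA subrK.
  apply: le_trans (ler_normD _ _) _; apply: le_trans (lerD h1 h2) _.
  by rewrite addrA subrK.
by have := step _ (leqnn _); rewrite xn.
Qed.

Lemma le0_of_le_mul (x k : R) : 0 <= k -> (forall e, 0 < e -> x <= e * k) -> x <= 0.
Proof.
move=> k0 xk; rewrite leNgt; apply/negP => x0.
have k1 : 0 < k + 1 by rewrite ltr_wpDl.
have e0 : 0 < x / 2 / (k + 1) by rewrite !divr_gt0.
have := xk _ e0; rewrite mulrAC ler_pdivlMr// -mulrA ler_pM2l//.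
by rewrite ler_pdivlMl//; lra.
Qed.

(** The product rule for the factor t - a.  Let I be the primitive of
    (t - a) g + u.  On a short interval [x, y] the increments of I and of
    (t - a) u differ by at most 2 (y - x) times the integral of |g| over [x, y],
    because u varies by at most that integral; such errors sum to 0. *)
Lemma W1q_derivativeM q a b u g : 1 <= q -> a <= b -> W1q_derivative q a b u g ->
  W1q_derivative q a b (fun t => (t - a) *: u t) (fun t => (t - a) *: g t + u t).
Proof.
move=> q1 ab W; have q0 : 0 <= q by exact: le_trans q1.
have [uL gL hu] := W.
have mid : strongly_measurable a b ((fun t => t - a) : R -> R^o).
  by apply: strongly_measurable_continuous => t _; apply: cvgB; [exact: cvg_id|exact: cvg_cst].
have ba0 : 0 <= b - a by rewrite subr_ge0.
have bnd t : t \in `]a, b[ -> `|t - a| <= b - a.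
  by rewrite in_itv/= => /andP[at_ tb]; rewrite ger0_norm ?subr_ge0 ?ltW// ltrD2r.
have muL (f : R -> E) (fL : in_Lq q a b f) : in_Lq q a b (fun t => (t - a) *: f t).
  exact: (in_Lq_scale q0 ba0 mid bnd fL).
pose g' t := (t - a) *: g t + u t.
have gL' : in_Lq q a b g' by exact: (@in_LqD _ E q a b (fun t => (t - a) *: g t) u q0 (muL g gL) uL).
split; [exact: (muL u uL)|exact: gL'|].
have /choice[I hI] : forall t, exists I, t \in `[a, b] -> has_bochner_integral a t g' I.
  move=> t; have [|tab] := boolP (t \in `[a, b]); last by exists 0.
  rewrite in_itv/= => /andP[at_ tb].
  have [I hI] := in_Lq_has_bochner_integral q1 (in_Lq_sub (lexx a) tb gL').
  by exists I.
move=> t tab; have := hI t tab.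
suff <- : I t = (t - a) *: u t - (a - a) *: u a by [].
have [at_ tb] : a <= t /\ t <= b by move: tab; rewrite in_itv/= => /andP.
have aab : a \in `[a, b] by rewrite in_itv/= lexx.
have Ia : I a = 0.
  have := has_bochner_integral_norm (lexx a) (hI a aab).
  by rewrite set_itvoo0 integral_set0 lee_fin normr_le0 => /eqP.
pose G x : R := fine (\int[mu]_(s in `]a, x[) `|g s|%:E)%E.
have mg : strongly_measurable a b g by case: gL.
have Gfin x y : a <= x -> x <= y -> y <= b ->
    (\int[mu]_(s in `]x, y[) `|g s|%:E)%E = (G y - G x)%:E.
  move=> ax xy yb; have fin z : z <= b -> (\int[mu]_(s in `]a, z[) `|g s|%:E)%E \is a fin_num.
    move=> zb; rewrite ge0_fin_numE ?integral_norm_ge0//.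
    exact: (in_Lq_integrable q1 (in_Lq_sub (lexx a) zb gL)).
  have := ae_integral_split ax xy (fun s => normr_ge0 (g s))
    (norm_ae_measurable (strongly_measurable_sub (lexx a) yb mg)).
  have fx := fin _ (le_trans xy yb); have fy := fin _ yb.
  rewrite EFinB /G !fineK// => ->.
  by rewrite addeAC subee// add0e.
suff : (fun t => I t - (t - a) *: u t) t = (fun t => I t - (t - a) *: u t) a.
  by rewrite /= Ia subrr scale0r subr0 => /eqP; rewrite subr_eq0 subr0 => /eqP.
have Gat : 0 <= G t - G a by rewrite -lee_fin -(Gfin a t)// integral_norm_ge0.
apply/eqP; rewrite -subr_eq0 -normr_le0; apply: (@le0_of_le_mul _ (2 * (G t - G a))).
  by rewrite mulr_ge0.
move=> e e0; rewrite mulrA mulrBr.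
apply: (@increments_telescope a t e (fun t => I t - (t - a) *: u t) (fun x => e * 2 * G x) at_ e0).
move=> x y ax xy yt yxe.
have yb := le_trans yt tb.
have xab : x \in `[a, b] by rewrite in_itv/= ax (le_trans xy yb).
have yab : y \in `[a, b] by rewrite in_itv/= (le_trans ax xy).
have hxy : has_bochner_integral x y g' (I y - I x).
  exact: has_bochner_integral_subinterval ax xy (hI y yab) (hI x xab).
have hu' z w : a <= z -> z <= w -> w <= b -> has_bochner_integral z w g (u w - u z).
  exact: has_bochner_integral_W1q W.
have hc := has_bochner_integralD (y - a) (has_bochner_integral_cst (u x) xy) (hu' x y ax xy yb).
have Gxy : 0 <= G y - G x by rewrite -lee_fin -(Gfin x y)// integral_norm_ge0.
have -> : I y - (y - a) *: u y - (I x - (x - a) *: u x) =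
    (I y - I x) - ((y - x) *: u x + (y - a) *: (u y - u x)).
  have -> : (y - x) *: u x + (y - a) *: (u y - u x) = (y - a) *: u y - (x - a) *: u x.
    rewrite scalerBr addrCA -scalerBl; congr (_ + _); rewrite -scaleNr; congr (_ *: _).
    by ring.
  by rewrite !opprD !opprK addrACA.
rewrite -lee_fin; apply: le_trans (has_bochner_integral_dist hxy hc) _.
have gxy : ae_measurable x y (fun t => `|g t|).
  by apply: norm_ae_measurable; exact: strongly_measurable_sub mg.
have yx0 : 0 <= y - x by rewrite subr_ge0.
apply: (@le_trans _ _ (\int[mu]_(s in `]x, y[) ((y - x) * `|g s| + (G y - G x))%:E)%E).
  apply: ae_integral_le => [//|s|]; first by rewrite addr_ge0// mulr_ge0.
  apply: aeW => s; rewrite in_itv/= => /andP[xs sy].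
  have -> : g' s - (cst (u x) s + (y - a) *: g s) = (s - y) *: g s + (u s - u x).
    rewrite /g'/= [u x + _]addrC opprD addrACA -scalerBl; congr (_ *: _ + _).
    by ring.
  apply: le_trans (ler_normD _ _) _; apply: lerD.
    rewrite normrZ ler_wpM2r// distrC ger0_norm ?subr_ge0 ?(ltW sy)//.
    by rewrite lerD2l lerN2 ltW.
  rewrite -lee_fin -(Gfin x y)//.
  apply: le_trans (has_bochner_integral_norm (ltW xs) (hu' x s ax (ltW xs) _)) _.
    exact: le_trans (ltW sy) yb.
  apply: integral_norm_sub; [exact: lexx|exact: ltW|].
  exact: strongly_measurable_sub mg.
rewrite ae_integralD; [|by move=> s; rewrite mulr_ge0|by []|exact: ae_measurableZ|exact: ae_measurable_cst].
rewrite ae_integralZ// integral_cst_itv// (Gfin x y)// -EFinM -EFinD lee_fin.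
have := ler_wpM2r Gxy yxe; lra.
Qed.

End SobolevFunctions.

(** * The algebra of functions of maximal regularity *)
Section MaximalRegularityData.
Context {R : realType} {X D : completeNormedModType R} (j : {linear D -> X}).
Local Notation mu := (@lebesgue_measure R).
Implicit Types (a b c d h q : R) (u g : R -> X) (v : R -> D).

Lemma MR_dataD q a b u1 g1 v1 u2 g2 v2 k : 0 <= q ->
  MR_data j q a b u1 g1 v1 -> MR_data j q a b u2 g2 v2 ->
  MR_data j q a b (fun t => u1 t + k *: u2 t) (fun t => g1 t + k *: g2 t)
    (fun t => v1 t + k *: v2 t).
Proof.
move=> q0 [W1 v1L uv1] [W2 v2L uv2]; split.
- exact: W1q_derivativeD.
- exact: (in_LqD q0 v1L (in_LqZ k q0 v2L)).
- by apply: filterS2 uv1 uv2 => t e1 e2 tab; rewrite linearD linearZ e1// e2.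
Qed.

Lemma MR_data_sub q a b c d u g v : a <= c -> c <= d -> d <= b ->
  MR_data j q a b u g v -> MR_data j q c d u g v.
Proof.
move=> ac cd db [W vL uv]; split; [exact: W1q_derivative_sub W|exact: in_Lq_sub vL|].
exact: ae_subinterval uv.
Qed.

Lemma MR_data_translation q a b h u g v : MR_data j q a b u g v ->
  MR_data j q (a + h) (b + h) (fun t => u (t - h)) (fun t => g (t - h)) (fun t => v (t - h)).
Proof.
move=> [W vL uv]; split; [exact: (W1q_derivative_translation h W)|exact: (in_Lq_translation h vL)|].
exact: (ae_translation_itv (P := fun t => u t = j (v t)) h uv).
Qed.

Lemma MR_data_cst q a b (x : D) : 0 <= q ->
  MR_data j q a b (cst (j x)) (cst 0) (cst x).
Proof.
move=> q0; split; [exact: W1q_derivative_cst|exact: in_Lq_cst|exact: aeW].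
Qed.

Lemma MR_dataM q a b u g v : 1 <= q -> a <= b -> MR_data j q a b u g v ->
  MR_data j q a b (fun t => (t - a) *: u t) (fun t => (t - a) *: g t + u t)
    (fun t => (t - a) *: v t).
Proof.
move=> q1 ab [W vL uv]; have q0 : 0 <= q by exact: le_trans q1.
split; first exact: W1q_derivativeM.
- apply: (in_Lq_scale (m := b - a) q0 _ _ _ vL); first by rewrite subr_ge0.
  + by apply: strongly_measurable_continuous => t _; apply: cvgB; [exact: cvg_id|exact: cvg_cst].
  + by move=> t; rewrite in_itv/= => /andP[at_ tb]; rewrite ger0_norm ?subr_ge0 ?ltW// ltrD2r.
- by apply: filterS uv => t e tab; rewrite linearZ e.
Qed.

End MaximalRegularityData.

(** * Extension by zero and exhaustion of an interval *)
Section Extensions.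
Context {R : realType} {E : completeNormedModType R}.
Local Notation mu := (@lebesgue_measure R).
Implicit Types (a b c d p : R) (f : R -> E).

Lemma continuous_linear_bound (F : completeNormedModType R) (B : {linear E -> F}) :
  continuous B -> exists2 c : R, 0 < c & forall x, `|B x| <= c * `|x|.
Proof.
move=> /linear_bounded_continuous/linear_boundedP/pinfty_ex_gt0[c c0 Bc].
by exists c.
Qed.

Lemma in_Lq_linear (F : completeNormedModType R) (B : {linear E -> F}) p a b f :
  0 <= p -> continuous B -> in_Lq p a b f -> in_Lq p a b (fun t => B (f t)).
Proof.
move=> p0 cB fL; have [c c0 Bc] := continuous_linear_bound cB.
have [mf _] := fL; apply: (in_Lq_le p0 (ltW c0) _ fL).
  exact: (strongly_measurable_comp cB mf).
by apply: aeW => t _; exact: Bc.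
Qed.

Lemma power_integral_eq0 p a b f : p != 0 -> (forall t, t \in `]a, b[ -> f t = 0) ->
  power_integral p a b f = 0%E.
Proof.
move=> p0 f0; rewrite /power_integral (eq_integral (cst 0%E)) ?integral0// => t.
by move=> /set_mem/= /f0 ->; rewrite normr0 powR0.
Qed.

Lemma eq_power_integral p a b f g : (forall t, t \in `]a, b[ -> f t = g t) ->
  power_integral p a b f = power_integral p a b g.
Proof. by move=> fg; apply: power_integral_ae; apply: aeW => t /fg ->. Qed.

Definition extend0 c d f : R -> E := fun t => if t \in `]c, d[%classic then f t else 0.

Lemma extend0_in c d f t : t \in `]c, d[ -> extend0 c d f t = f t.
Proof. by move=> tcd; rewrite /extend0 mem_set. Qed.

Lemma extend0_out c d f t : t \notin `]c, d[ -> extend0 c d f t = 0.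
Proof. by move=> /negP tcd; rewrite /extend0 memNset. Qed.

Lemma strongly_measurable_extend0 a b c d f : strongly_measurable c d f ->
  strongly_measurable a b (extend0 c d f).
Proof.
move=> [s [ss cs]]; exists (fun n => extend0 c d (s n)); split.
  move=> n; apply: simple_map_if; [by []|exact: ss|exact: simple_map_cst].
apply: filterS cs => t st _; rewrite /extend0; case: ifPn => [/set_mem/st //|_].
exact: cvg_cst.
Qed.

Lemma power_integral_extend0 p a b c d f : p != 0 -> a <= c -> c <= d -> d <= b ->
  strongly_measurable c d f ->
  power_integral p a b (extend0 c d f) = power_integral p c d f.
Proof.
move=> p0 ac cd db mf.
have me u v : strongly_measurable u v (extend0 c d f) by exact: strongly_measurable_extend0.
rewrite (power_integral_split p ac (le_trans cd db))//.
rewrite (power_integral_split p cd db)//.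
rewrite (@power_integral_eq0 p a c)//; last first.
  move=> t; rewrite in_itv/= => /andP[_ tc]; apply: extend0_out.
  by rewrite in_itv/= ltNge (ltW tc).
rewrite (@power_integral_eq0 p d b)//; last first.
  move=> t; rewrite in_itv/= => /andP[dt _]; apply: extend0_out.
  by rewrite in_itv/= [_ < d]ltNge (ltW dt) andbF.
rewrite add0e adde0; apply: eq_power_integral => t; exact: extend0_in.
Qed.

Lemma in_Lq_extend0 p a b c d f : p != 0 -> a <= c -> c <= d -> d <= b ->
  in_Lq p c d f -> in_Lq p a b (extend0 c d f).
Proof.
move=> p0 ac cd db [mf fin]; split; first exact: strongly_measurable_extend0.
by have := power_integral_extend0 p0 ac cd db mf; rewrite /power_integral => ->.
Qed.

Section Exhaustion.
Variables (p a b : R) (k : nat -> R) (f : R -> E) (C : R).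
Hypothesis k0 : k 0%N = a.
Hypothesis k_nd : forall n, k n <= k n.+1.
Hypothesis k_b : forall n, k n <= b.
Hypothesis k_sup : forall t, t < b -> exists n, t < k n.
Hypothesis mf : forall n, strongly_measurable a (k n) f.

Let k_le m n : (m <= n)%N -> k m <= k n.
Proof.
elim: n => [|n IH]; first by rewrite leqn0 => /eqP ->.
rewrite leq_eqVlt ltnS => /orP[/eqP -> //|/IH mn]; exact: le_trans mn (k_nd n).
Qed.

(** On each interval between consecutive knots, approximations of f up to the
    next knot are used; only m of these intervals are served at stage m, so that
    the range stays finite. *)
Lemma strongly_measurable_exhaustion : strongly_measurable a b f.
Proof.
have /choice[s hs] : forall n, exists s, simple_approximation a (k n) s f by [].
pose I n := `[k n, k n.+1[%classic.
pose S m t : E := \sum_(i < m) if t \in I i then s i.+1 m t else 0.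
exists S; split.
  move=> m; have h (q : nat) : simple_map (fun t => \sum_(i < q) if t \in I i then s i.+1 m t else 0).
    elim: q => [|q IH].
      under eq_fun do rewrite big_ord0; exact: simple_map_cst.
    under eq_fun do rewrite big_ord_recr/=.
    apply: (simple_map_comp2 (fun x y => x + y) IH).
    apply: simple_map_if; [exact: measurable_itv|exact: (hs q.+1).1|exact: simple_map_cst].
  exact: h.
have : {ae mu, forall t n, t \in `]a, k n[ -> s n m t @[m --> \oo] --> f t}.
  by apply: ae_foralln => n; exact: (hs n).2.
apply: filterS => t ct; rewrite in_itv/= => /andP[at_ tb].
have [n tn] := k_sup tb.
have [[|i] ti imin] := ex_minnP (ex_intro (fun n => t < k n) n tn).
  by move: ti; rewrite k0 => /(lt_trans at_); rewrite ltxx.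
have kit : k i <= t by rewrite leNgt; apply/negP => /imin; rewrite ltnn.
have inI l : (t \in I l) = (l == i).
  apply/idP/eqP => [/set_mem/=|->]; last by apply/mem_set; rewrite /I /= in_itv/= kit.
  rewrite /I /= in_itv/= => /andP[lt tl]; apply/eqP; rewrite eqn_leq.
  have -> /= : (i <= l)%N by rewrite -ltnS; exact: imin.
  rewrite andbT leqNgt; apply/negP => il.
  by move: (lt_le_trans ti (le_trans (k_le il) lt)); rewrite ltxx.
have cti : t \in `]a, k i.+1[ by rewrite in_itv/= at_ ti.
apply: cvg_trans (ct i.+1 cti); apply: near_eq_cvg; exists i.+1 => // m /= im.
rewrite /S (bigD1 (Ordinal im))//= inI eqxx big1 ?addr0// => l li.
by rewrite inI; case: eqP => // e; move/negP: li; case; apply/eqP/val_inj.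
Qed.

Lemma power_integral_exhaustion :
  (forall n, (power_integral p a (k n) f <= C%:E)%E) -> (power_integral p a b f <= C%:E)%E.
Proof.
move=> fC; have mab := strongly_measurable_exhaustion.
have [h [mh h0 fh]] := power_ae_measurable p mab.
have fhE n : power_integral p a (k n) f = (\int[mu]_(t in `]a, k n[) (h t)%:E)%E.
  apply: ae_integralE; [by move=> t; exact: powR_ge0|exact: h0|].
  exact: ae_subinterval fh.
rewrite /power_integral (ae_integralE _ h0 fh); last by move=> t; exact: powR_ge0.
have -> : `]a, b[%classic = \bigcup_i `]a, k i[%classic.
  apply/seteqP; split => [t|t [i _]] /=; rewrite !in_itv/= => /andP[at_ tb].
    by have [n tn] := k_sup tb; exists n => //=; rewrite in_itv/= at_.
  by rewrite at_/=; exact: lt_le_trans tb (k_b i).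
have nd : nondecreasing_seq (fun i => `]a, k i[%classic : set (measurableTypeR R)).
  move=> m n mn; apply/subsetPset => t /=; rewrite !in_itv/= => /andP[-> tm]/=.
  exact: lt_le_trans tm (k_le mn).
have mh' i : measurable_fun (`]a, k i[%classic : set (measurableTypeR R)) (EFin \o h).
  by apply/measurable_EFinP; exact: measurable_funTS.
have pos i t : (`]a, k i[%classic : set (measurableTypeR R)) t -> (0 <= (EFin \o h) t)%E.
  by rewrite lee_fin.
have cv := ge0_nondecreasing_set_cvg_integral (mu := mu) nd
  (fun i => measurable_itv _) mh' pos.
rewrite -(cvg_lim _ cv)//; apply: lime_le; first exact: (cvgP _ cv).
by apply: nearW => n; rewrite -fhE.
Qed.

Lemma in_Lq_exhaustion :
  (forall n, (power_integral p a (k n) f <= C%:E)%E) -> in_Lq p a b f.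
Proof.
move=> fC; apply: (in_Lq_fin (r := C)); first exact: strongly_measurable_exhaustion.
exact: power_integral_exhaustion.
Qed.

End Exhaustion.

End Extensions.

(** * Uniqueness of solutions *)
Section UniquenessOfSolutions.
Context {R : realType} {X D : completeNormedModType R} (j : {linear D -> X}).
Hypothesis j_inj : injective j.
Variables (p : R) (B : {linear D -> X}).
Hypotheses (p1 : 1 < p) (B_cont : continuous B) (B_MR : maximal_regularity j B).
Local Notation mu := (@lebesgue_measure R).
Implicit Types (a b c d h q : R) (u g : R -> X) (v : R -> D).

Let p0 : 0 <= p. Proof. exact: le_trans ler01 (ltW p1). Qed.

Lemma in_Lq_residual a b u g v : MR_data j p a b u g v ->
  in_Lq p a b (fun t => g t + B (v t)).
Proof.
move=> [[_ gL _] vL _].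
exact: (@in_LqD _ X p a b g (fun t => B (v t)) p0 gL (in_Lq_linear p0 B_cont vL)).
Qed.

(** The difference solves the homogeneous problem from rest, as 0 does; equality
    in X passes to D because j is injective. *)
Lemma MR_data_unique a b u1 g1 v1 u2 g2 v2 : a < b ->
  MR_data j p a b u1 g1 v1 -> MR_data j p a b u2 g2 v2 -> u1 a = u2 a ->
  {ae mu, forall t, t \in `]a, b[ -> g1 t + B (v1 t) = g2 t + B (v2 t)} ->
  (forall t, t \in `[a, b] -> u1 t = u2 t) /\
  {ae mu, forall t, t \in `]a, b[ -> v1 t = v2 t}.
Proof.
move=> ab M1 M2 ua res.
have M := MR_dataD (-1) p0 M1 M2.
have M0 := MR_data_cst j a b (0 : D) p0.
have [_ uniq] := B_MR p1 ab (in_Lq_cst a b (0 : X) p0).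
have uE t : t \in `[a, b] -> u1 t = u2 t.
  move=> tab; apply/eqP; rewrite -subr_eq0 -[- u2 t]scaleN1r; apply/eqP.
  rewrite -(linear0 j); apply: (uniq (fun t => u1 t + -1 *: u2 t) (cst (j 0))) => //.
  - exists (fun t => g1 t + -1 *: g2 t), (fun t => v1 t + -1 *: v2 t); split => //.
    apply: filterS res => s e sab; rewrite linearD linearZ/= addrACA e// -scalerDr.
    by rewrite scaleN1r subrr.
  - by rewrite ua scaleN1r subrr.
  - exists (cst 0), (cst 0); split => //.
    by apply: aeW => s _; rewrite /= linear0 addr0.
  - by rewrite /= linear0.
split => //; have [_ _ j1] := M1; have [_ _ j2] := M2.
apply: filterS2 j1 j2 => t e1 e2 tab; apply: j_inj; rewrite -e1// -e2//; apply: uE.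
by apply: subset_itv_oo_cc.
Qed.

End UniquenessOfSolutions.

(** * The estimate of maximal regularity, by a gliding hump *)
Section GlidingHump.
Context {R : realType} {X D : completeNormedModType R} (j : {linear D -> X}).
Hypothesis j_inj : injective j.
Variables (p : R) (B : {linear D -> X}).
Hypotheses (p1 : 1 < p) (B_cont : continuous B) (B_MR : maximal_regularity j B).
Local Notation mu := (@lebesgue_measure R).
Implicit Types (a b c d h q : R) (u g : R -> X) (v : R -> D).

Let p0 : 0 <= p. Proof. exact: le_trans ler01 (ltW p1). Qed.
Let p_neq0 : p != 0. Proof. by rewrite gt_eqF// (lt_trans ltr01). Qed.

Definition regularity_estimate (L K : R) := forall a b u g v,
  a < b -> b - a <= L -> MR_data j p a b u g v -> u a = 0 ->
  (power_integral p a b v <= K%:E * power_integral p a b (fun t => (g t + B (v t))%R))%E.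

(** The knots cut (0, 1) into infinitely many intervals, of length 2^-(n+1). *)
Let knot n : R := 1 - 2^-1 ^+ n.

Let knotS n : knot n.+1 = knot n + 2^-1 ^+ n.+1.
Proof. by rewrite /knot exprS; set x := _ ^+ n; lra. Qed.

Let half_gt0 n : 0 < 2^-1 ^+ n :> R. Proof. by rewrite exprn_gt0// invr_gt0. Qed.

Let knot0 : knot 0%N = 0. Proof. by rewrite /knot expr0 subrr. Qed.

Let knot_ltS n : knot n < knot n.+1. Proof. by rewrite knotS ltrDl. Qed.

Let knot_le m n : (m <= n)%N -> knot m <= knot n.
Proof.
elim: n => [|n IH]; first by rewrite leqn0 => /eqP ->.
by rewrite leq_eqVlt ltnS => /orP[/eqP -> //|/IH mn]; exact: le_trans mn (ltW (knot_ltS n)).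
Qed.

Let knot_ge0 n : 0 <= knot n. Proof. by rewrite -knot0 knot_le. Qed.

Let knot_lt1 n : knot n < 1. Proof. by rewrite /knot ltrBlDr ltrDl. Qed.

Let knot_sup t : t < 1 -> exists n, t < knot n.
Proof.
move=> t1; have cv : (fun n => 2^-1 ^+ n : R) @ \oo --> 0.
  by apply: cvg_expr; rewrite gtr0_norm ?invr_gt0// invf_lt1// ltr1n.
have t1' : 0 < 1 - t by rewrite subr_gt0.
have [n _ hn] := cvgr_lt _ cv _ t1'.
by exists n; have := hn n (leqnn n); rewrite /knot /=; lra.
Qed.

(** A forcing term carried by the n-th interval, small in L^p(X), whose solution
    started from rest is large in L^p(D).  The mass 2 * 2^p is such that, after
    the factor 2^p of the triangle inequality, a perturbation of mass less than 1
    leaves a mass at least 1. *)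
Record hump n := Hump {
  hump_end : R;
  hump_force : R -> X;
  hump_u : R -> X;
  hump_g : R -> X;
  hump_v : R -> D;
  hump_lt : knot n < hump_end;
  hump_le : hump_end <= knot n.+1;
  hump_MR : MR_data j p (knot n) hump_end hump_u hump_g hump_v;
  hump_start : hump_u (knot n) = 0;
  hump_eq : forall t, t \in `]knot n, hump_end[ -> hump_g t + B (hump_v t) = hump_force t;
  hump_out : forall t, t \notin `]knot n, hump_end[ -> hump_force t = 0;
  hump_Lq : in_Lq p 0 1 hump_force;
  hump_small : (power_integral p 0 1 hump_force <= (2^-1 ^+ n)%:E)%E;
  hump_large : power_integral p (knot n) hump_end hump_v = (2 * 2 `^ p)%:E
}.

(** A counterexample to the estimate, translated to start at the n-th knot and
    rescaled to the prescribed mass. *)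
Let hump_exists : (forall L K, 0 < L -> 0 < K -> ~ regularity_estimate L K) ->
  forall n, inhabited (hump n).
Proof.
move=> noest n.
pose K : R := 2 * 2 `^ p * 2 ^+ n.
have K0 : 0 < K by rewrite !mulr_gt0 ?powR_gt0 ?exprn_gt0.
have := noest (2^-1 ^+ n.+1) K (half_gt0 _) K0.
move/existsNP => [a] /existsNP[b] /existsNP[u] /existsNP[g] /existsNP[v].
move=> /not_implyP[ab] /not_implyP[bL] /not_implyP[M] /not_implyP[ua] /negP.
rewrite -ltNge => big.
have resL := in_Lq_residual p1 B_cont M.
have [_ vL _] := M.
have [r r0 vr] := power_integral_fin vL.
have [q q0 fq] := power_integral_fin resL.
rewrite vr fq -EFinM lte_fin in big.
have r_gt0 : 0 < r by apply: le_lt_trans big; rewrite mulr_ge0// ltW.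
(* Scaling by l gives the solution the mass 2 * 2^p. *)
pose l : R := (2 * 2 `^ p / r) `^ p^-1.
have lp : l `^ p = 2 * 2 `^ p / r.
  rewrite -powRrM mulVf// powRr1// divr_ge0 ?mulr_ge0 ?powR_ge0//.
have l0 : 0 <= l by exact: powR_ge0.
pose h := knot n - a.
have Mh := MR_data_translation h M.
have M0 := MR_data_cst j (a + h) (b + h) (0 : D) p0.
have Ml := MR_dataD l p0 M0 Mh.
have ah : a + h = knot n by rewrite /h addrC subrK.
have abh : a + h < b + h by rewrite ltrD2r.
have bh : b + h <= knot n.+1.
  by rewrite knotS -ah -addrA [h + _]addrC addrA lerD2r -lerBlDl.
pose g' t : X := cst 0 t + l *: g (t - h).
pose v' t : D := cst 0 t + l *: v (t - h).
pose f t := g' t + B (v' t).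
have fE t : f t = l *: (g (t - h) + B (v (t - h))).
  by rewrite /f /g' /v' /= !add0r linearZ scalerDr.
have fL : in_Lq p (a + h) (b + h) f := in_Lq_residual p1 B_cont Ml.
have hb1 : b + h <= 1 by exact: le_trans bh (ltW (knot_lt1 _)).
have ha0 : 0 <= a + h by rewrite ah.
constructor.
apply: (@Hump n (b + h) (extend0 (a + h) (b + h) f)
  (fun t => cst (j 0) t + l *: u (t - h)) g' v').
- by rewrite -ah.
- exact: bh.
- by rewrite -ah.
- by rewrite -ah addrK ua scaler0 addr0 /= linear0.
- by move=> t; rewrite -ah => tab; rewrite extend0_in.
- by move=> t; rewrite -ah => tab; rewrite extend0_out.
- exact: in_Lq_extend0 (ltW abh) hb1 fL.
- rewrite power_integral_extend0//; [|exact: ltW|by case: fL].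
  rewrite (eq_power_integral p (fun t _ => fE t)).
  have [mres _] := resL.
  rewrite (power_integralZ _ p0 (strongly_measurable_translation h mres)).
  rewrite (power_integral_translation p h mres) fq -EFinM lee_fin (ger0_norm l0) lp.
  rewrite exprVn -[leRHS]mul1r ler_pdivlMr ?exprn_gt0//.
  have -> : 2 * 2 `^ p / r * q * 2 ^+ n = K * q / r by rewrite /K; ring.
  by rewrite ler_pdivrMr// mul1r ltW.
- have -> : power_integral p (knot n) (b + h) v' = power_integral p (a + h) (b + h) (fun t => l *: v (t - h)).
    by rewrite ah; apply: eq_power_integral => t _; rewrite /v' /= add0r.
  have [mv _] := vL.
  rewrite (power_integralZ _ p0 (strongly_measurable_translation h mv)).
  rewrite (power_integral_translation p h mv) vr -EFinM (ger0_norm l0) lp.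
  by rewrite divfK// gt_eqF.
Qed.

Let solution_exists : forall F : R -> X, exists w : (R -> X) * (R -> X) * (R -> D),
  in_Lq p 0 1 F -> [/\ MR_data j p 0 1 w.1.1 w.1.2 w.2, w.1.1 0 = 0 &
    {ae mu, forall t, t \in `]0, 1[ -> w.1.2 t + B (w.2 t) = F t}].
Proof.
move=> F; have [FL|nFL] := pselect (in_Lq p 0 1 F); last first.
  by exists (cst 0, cst 0, cst 0).
have [[u [[g [v [M e]]] u0]] _] := B_MR p1 ltr01 FL.
by exists (u, g, v).
Qed.

Section Superposition.
Variable H : forall n, hump n.
Variable sol : (R -> X) -> (R -> X) * (R -> X) * (R -> D).
Hypothesis solP : forall F : R -> X, in_Lq p 0 1 F ->
  [/\ MR_data j p 0 1 (sol F).1.1 (sol F).1.2 (sol F).2, (sol F).1.1 0 = 0 &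
    {ae mu, forall t, t \in `]0, 1[ -> (sol F).1.2 t + B ((sol F).2 t) = F t}].

(** The n-th hump is added only if the response to the previous ones is not
   already large on the n-th interval. *)
Let active n (F : R -> X) : bool :=
  `[< (power_integral p (knot n) (hump_end (H n)) (sol F).2 < 1%:E)%E >].

Fixpoint partial_force n : R -> X :=
  if n is m.+1 then fun t => partial_force m t +
    (active m (partial_force m))%:R *: hump_force (H m) t
  else cst 0.

Let force_out n t : t <= knot n \/ knot n.+1 <= t -> hump_force (H n) t = 0.
Proof.
move=> ht; apply: hump_out; rewrite in_itv/=; case: ht => h; apply/negP => /andP[h1 h2].
  by move: (lt_le_trans h1 h); rewrite ltxx.
by move: (lt_le_trans h2 (le_trans (hump_le (H n)) h)); rewrite ltxx.
Qed.

Let partial_out n t : knot n <= t -> partial_force n t = 0.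
Proof.
elim: n => [//|n IH] nt /=.
rewrite IH; last exact: le_trans (ltW (knot_ltS n)) nt.
by rewrite force_out; [rewrite scaler0 addr0|right].
Qed.

Let partial_stable n m t : (n <= m)%N -> t <= knot n -> partial_force m t = partial_force n t.
Proof.
elim: m => [|m IH]; first by rewrite leqn0 => /eqP ->.
rewrite leq_eqVlt ltnS => /orP[/eqP -> //|nm] tn /=.
rewrite force_out; first by rewrite scaler0 addr0 IH.
by left; exact: le_trans tn (knot_le nm).
Qed.

Let partial_Lq n : in_Lq p 0 1 (partial_force n).
Proof.
elim: n => [|n IH]; first exact: in_Lq_cst.
exact: (in_LqD p0 IH (in_LqZ _ p0 (hump_Lq (H n)))).
Qed.

Let partial_small n :
  (power_integral p 0 (knot n) (partial_force n) <= (2 - 2 * 2^-1 ^+ n)%:E)%E.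
Proof.
elim: n => [|n IH].
  by rewrite power_integral_empty ?knot0// lee_fin expr0; lra.
have [mS _] := partial_Lq n.+1.
rewrite (@power_integral_split _ _ p 0 (knot n.+1) (knot n))//; last 2 first.
- exact: ltW.
- exact: strongly_measurable_sub (lexx _) (ltW (knot_lt1 _)) mS.
have -> : 2 - 2 * 2^-1 ^+ n.+1 = (2 - 2 * 2^-1 ^+ n) + 2^-1 ^+ n :> R.
  by rewrite exprS; set x := _ ^+ n; lra.
rewrite EFinD; apply: leeD.
  rewrite (_ : power_integral p 0 (knot n) _ = power_integral p 0 (knot n) (partial_force n))//.
  apply: eq_power_integral => t; rewrite in_itv/= => /andP[_ /ltW tn].
  exact: (partial_stable (leqnSn n) tn).
apply: le_trans (hump_small (H n)).
apply: le_trans (power_integral_sub p _ (knot_ge0 n) (ltW (knot_lt1 n.+1))).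
apply: power_integral_le => //; apply: aeW => t; rewrite in_itv/= => /andP[nt _].
rewrite (partial_out (ltW nt)) add0r normrZ ler_piMl//.
by case: active; rewrite ?normr1 ?normr0.
Qed.

(** Before the n-th knot all partial forces from the n-th on agree; the default of
    xget only concerns times from 1 on. *)
Let total_force t : X := partial_force (xget 0%N [set n | t < knot n]) t.

Let total_partial n t : t < knot n -> total_force t = partial_force n t.
Proof.
move=> tn; rewrite /total_force; set m := xget _ _.
have tm : t < knot m by rewrite /m; case: xgetP => [? -> //|/(_ n)]; case.
have [mn|/ltnW nm] := leqP m n; first by rewrite (partial_stable mn)// ltW.
by rewrite (partial_stable nm)// ltW.
Qed.

Let total_Lq : in_Lq p 0 1 total_force.
Proof.
apply: (@in_Lq_exhaustion _ _ p 0 1 knot total_force 2 knot0).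
- by move=> n; exact: ltW.
- by move=> n; exact: ltW.
- exact: knot_sup.
- move=> n; have [mF _] := partial_Lq n.
  apply: (strongly_measurable_ae _ (strongly_measurable_sub (lexx 0) (ltW (knot_lt1 n)) mF)).
  by apply: aeW => t; rewrite in_itv/= => /andP[_ tn]; rewrite (total_partial tn).
- move=> n; rewrite (@eq_power_integral _ _ p 0 (knot n) _ (partial_force n)).
    by apply: le_trans (partial_small n) _; rewrite lee_fin lerBlDr lerDl mulr_ge0// ltW.
  by move=> t; rewrite in_itv/= => /andP[_ tn]; rewrite (total_partial tn).
Qed.

(** Up to the n-th knot the total force is the n-th partial force, so the
    solutions agree there.  On the interval of the n-th hump they still agree if
    the hump was discarded, and differ by the solution of the hump otherwise. *)
Let response_large n : (1%:E <= power_integral p (knot n) (hump_end (H n)) (sol total_force).2)%E.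
Proof.
have [M M0 Me] := solP total_Lq.
set u := (sol total_force).1.1 in M M0; set g := (sol total_force).1.2 in M Me.
set v := (sol total_force).2 in M Me *.
have [N N0 Ne] := solP (partial_Lq n).
set un := (sol (partial_force n)).1.1 in N N0.
set gn := (sol (partial_force n)).1.2 in N Ne.
set vn := (sol (partial_force n)).2 in N Ne.
have start : u (knot n) = un (knot n).
  have [n0|n0] := posnP n; first by rewrite n0 knot0 M0 N0.
  have k0 : 0 < knot n by rewrite -knot0; apply: lt_le_trans (knot_ltS 0) _; exact: knot_le.
  have s1 := ltW (knot_lt1 n).
  have [|uE _] := MR_data_unique j_inj p1 B_MR k0 (MR_data_sub (lexx 0) (ltW k0) s1 M)
    (MR_data_sub (lexx 0) (ltW k0) s1 N) (etrans M0 (esym N0)); last first.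
    by apply: uE; rewrite in_itv/= lexx ltW.
  apply: filterS2 (ae_subinterval (lexx 0) s1 Me) (ae_subinterval (lexx 0) s1 Ne).
  move=> t e1 e2 tk; rewrite e1// e2//; apply: total_partial.
  by move: tk; rewrite in_itv/= => /andP[].
have e_lt := hump_lt (H n).
have e_le1 : hump_end (H n) <= 1 by exact: le_trans (hump_le (H n)) (ltW (knot_lt1 _)).
have Mn := MR_data_sub (knot_ge0 n) (ltW e_lt) e_le1 M.
have Nn := MR_data_sub (knot_ge0 n) (ltW e_lt) e_le1 N.
have Men := ae_subinterval (knot_ge0 n) e_le1 Me.
have Nen := ae_subinterval (knot_ge0 n) e_le1 Ne.
have totE t : t \in `]knot n, hump_end (H n)[ -> total_force t =
    partial_force n t + (active n (partial_force n))%:R *: hump_force (H n) t.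
  rewrite in_itv/= => /andP[_ te]; rewrite (@total_partial n.+1)//.
  exact: lt_le_trans te (hump_le (H n)).
have [act|nact] := boolP (active n (partial_force n)); last first.
  have [|_ vE] := MR_data_unique j_inj p1 B_MR e_lt Mn Nn start.
    apply: filterS2 Men Nen => t e1 e2 te; rewrite e1// e2// totE//.
    by rewrite (negbTE nact) scale0r addr0.
  rewrite (_ : power_integral _ _ _ v = power_integral p (knot n) (hump_end (H n)) vn); last first.
    by apply: power_integral_ae; apply: filterS vE => t e te; rewrite e.
  by move: nact; rewrite /active => /asboolPn/negP; rewrite -leNgt.
have HM := hump_MR (H n).
have S := MR_dataD 1 p0 Nn HM.
have S0 : u (knot n) = un (knot n) + 1 *: hump_u (H n) (knot n).
  by rewrite hump_start scaler0 addr0.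
have [|_ vE] := MR_data_unique j_inj p1 B_MR e_lt Mn S S0.
  apply: filterS2 Men Nen => t e1 e2 te; rewrite e1// totE// act !scale1r.
  by rewrite linearD addrACA e2// hump_eq.
move: act; rewrite /active => /asboolP small.
have [_ vnL _] := Nn; have [_ vL _] := Mn.
have [r r0 vr] := power_integral_fin vL; have [q q0 vnq] := power_integral_fin vnL.
have : (power_integral p (knot n) (hump_end (H n)) (hump_v (H n)) <=
    (2 `^ p)%:E * (power_integral p (knot n) (hump_end (H n)) v +
                   power_integral p (knot n) (hump_end (H n)) vn))%E.
  apply: power_integral_leD; [exact: p0|by case: vL|by case: vnL|].
  apply: filterS vE => t e te; have -> : hump_v (H n) t = v t - vn t.
    by rewrite e// scale1r addrC addKr.
  exact: ler_normB.
rewrite hump_large vr vnq -EFinD -EFinM !lee_fin mulrC.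
rewrite vnq lte_fin in small.
by rewrite ler_pM2l ?powR_gt0//; lra.
Qed.

Lemma humps_absurd : False.
Proof.
have [M _ _] := solP total_Lq.
have [_ vL _] := M; have [mv _] := vL.
set v := (sol total_force).2 in vL mv.
have grow n : ((n%:R)%:E <= power_integral p 0 (knot n) v)%E.
  elim: n => [|n IH]; first exact: power_integral_ge0.
  have k1 := ltW (knot_lt1 n.+1).
  rewrite (@power_integral_split _ _ p 0 (knot n.+1) (knot n))//; last 2 first.
  - exact: ltW.
  - exact: strongly_measurable_sub (lexx _) k1 mv.
  rewrite -natr1 EFinD; apply: leeD => //.
  apply: le_trans (response_large n) _.
  by apply: power_integral_sub; [exact: lexx|exact: hump_le].
have [r r0 vr] := power_integral_fin vL.
have := grow (Num.truncn r).+1.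
apply/negP; rewrite -ltNge.
apply: le_lt_trans (power_integral_sub p _ (lexx 0) (ltW (knot_lt1 _))) _.
rewrite vr lte_fin; exact: truncnS_gt.
Qed.

End Superposition.

(** The length L is allowed to be small because the humps must fit into the
    intervals between the knots. *)
Theorem maximal_regularity_estimate :
  exists L K, [/\ 0 < L, 0 < K & regularity_estimate L K].
Proof.
apply: contrapT => noest.
have noest' L K : 0 < L -> 0 < K -> ~ regularity_estimate L K.
  by move=> L0 K0 est; apply: noest; exists L, K.
have H n : hump n := inhabited_witness (hump_exists noest' n).
have [sol solP] := choice solution_exists.
exact: (humps_absurd H solP).
Qed.

End GlidingHump.

(** * Strongly continuous semigroups *)
Section UniformBoundedness.
Context {R : realType} {X : completeNormedModType R}.

Lemma uniform_operator_bound (I : Type) (P : I -> Prop) (F : I -> {linear X -> X}) :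
  (forall i, P i -> continuous (F i)) ->
  (forall x, exists M, forall i, P i -> `|F i x| <= M) ->
  exists2 M : R, 0 < M & forall i x, P i -> `|F i x| <= M * `|x|.
Proof.
move=> Fc Fb.
pose S : set (X -> X) := [set f | exists2 i, P i & f = (F i : X -> X)].
have [||M hM] := @Banach_Steinhauss R X X S _ _ 1.
- move=> _ [i Pi ->]; split; last by move=> k x y; rewrite linearP.
  have [c c0 Bc] := continuous_linear_bound (Fc i Pi).
  move=> r; exists (c * r) => x xr; apply: le_trans (Bc x) _.
  by rewrite ler_pM2l.
- by move=> x; have [M hM] := Fb x; exists M => _ [i Pi ->]; exact: hM.
exists (`|M| + 1) => [|i x Pi]; first by rewrite ltr_wpDl.
have [->|x0] := eqVneq x 0; first by rewrite linear0 normr0 mulr0.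
have nx : 0 < `|x| by rewrite normr_gt0.
have := hM (F i) (ex_intro2 _ _ i Pi erefl) (`|x|^-1 *: x).
rewrite normrZ normfV normr_id mulVf ?gt_eqF// => /(_ (lexx _)).
rewrite linearZ normrZ normfV normr_id ler_pdivrMl// => /le_trans; apply.
by rewrite mulrC ler_pM2r// (le_trans (ler_norm _))// lerDl.
Qed.

End UniformBoundedness.

Section Semigroups.
Context {R : realType} {X : completeNormedModType R} (T : R -> {linear X -> X}).
Hypothesis T_C0 : C0_semigroup T.
Local Notation mu := (@lebesgue_measure R).

Let T_cont r : 0 <= r -> continuous (T r). Proof. by move=> ?; case: T_C0 => h _ _ _; exact: h. Qed.
Let T0 x : T 0 x = x. Proof. by case: T_C0. Qed.
Let TD r s x : 0 <= r -> 0 <= s -> T (r + s) x = T r (T s x).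
Proof. by move=> r0 s0; case: T_C0 => _ _ h _; exact: h. Qed.

Let T_right x e : 0 < e ->
  exists2 d, 0 < d & forall r, 0 <= r -> r < d -> `|T r x - x| <= e.
Proof.
move=> e0; case: T_C0 => _ _ _ /(_ x)/cvgrPdist_le/(_ e e0).
rewrite near_withinE => /nbhs_ballP[d /= d0 hd]; exists d => // r r0 rd.
move: r0; rewrite le_eqVlt => /orP[/eqP <-|r0]; first by rewrite T0 subrr normr0 ltW.
rewrite distrC; apply: hd => //.
by rewrite /ball/= sub0r normrN gtr0_norm.
Qed.

(** Otherwise some operators T(r_n) with r_n tending to 0 would have norms larger
    than n, although T(r_n) x converges to x for every x. *)
Lemma C0_semigroup_bound : exists d M : R, [/\ 0 < d, 0 < M &
  forall r x, 0 <= r -> r <= d -> `|T r x| <= M * `|x|].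
Proof.
apply: contrapT => nobound.
have /choice[w hw] : forall n : nat, exists w : R * X,
    [/\ 0 <= w.1, w.1 <= n.+1%:R^-1 & n.+1%:R * `|w.2| < `|T w.1 w.2|].
  move=> n; apply: contrapT => nw; apply: nobound.
  exists n.+1%:R^-1, n.+1%:R; split; [by rewrite invr_gt0|by []|].
  move=> r x r0 rn; rewrite leNgt; apply/negP => big; apply: nw.
  by exists (r, x).
have [||M M0 hM] := @uniform_operator_bound R X nat (fun=> True) (fun n => T (w n).1).
- by move=> n _; apply: T_cont; have [] := hw n.
- move=> x; have [d d0 hd] := @T_right x 1 ltr01.
  have [N _ hN] : \forall n \near \oo, n.+1%:R^-1 < d.
    exact: (cvgr_lt _ (@cvg_harmonic R) _ d0).
  exists (`|x| + 1 + \sum_(i < N) `|T (w i).1 x|) => n _.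
  have s0 : 0 <= \sum_(i < N) `|T (w i).1 x| by exact: sumr_ge0.
  have [nN|Nn] := ltnP n N.
    rewrite (bigD1 (Ordinal nN))//= addrCA lerDl addr_ge0 ?addr_ge0//.
    exact: sumr_ge0.
  have [w0 wn _] := hw n; apply: ler_wpDr => //.
  rewrite -[T _ x](subrK x) addrC; apply: le_trans (ler_normD _ _) _; rewrite lerD2l.
  by apply: hd => //; apply: le_lt_trans wn (hN n Nn).
have [_ _ big] := hw (Num.truncn M).
have x0 : 0 < `|(w (Num.truncn M)).2|.
  rewrite normr_gt0; apply/eqP => x0; move: big.
  by rewrite x0 linear0 normr0 mulr0 ltxx.
have := lt_le_trans big (hM _ _ Logic.I).
by rewrite ltr_pM2r// ltNge => /negP; apply; apply/ltW/truncnS_gt.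
Qed.

Section LocallyBounded.
Variables (d M : R).
Hypotheses (d0 : 0 < d) (M0 : 0 < M).
Hypothesis TM : forall r x, 0 <= r -> r <= d -> `|T r x| <= M * `|x|.

(** Since T(t) - T(s) = T(s) (T(t - s) - 1), the modulus of continuity at 0 serves
    at all times. *)
Lemma C0_semigroup_uniform x e : 0 < e -> exists2 h, 0 < h &
  forall s t, 0 <= s -> s <= t -> t <= d -> t - s < h -> `|T t x - T s x| <= e.
Proof.
move=> e0; have eM : 0 < e / M by rewrite divr_gt0.
have [h h0 hh] := T_right x eM; exists h => // s t s0 st td tsh.
have ts0 : 0 <= t - s by rewrite subr_ge0.
have -> : T t x - T s x = T s (T (t - s) x - x).
  by rewrite linearB -TD// [s + _]addrC subrK.
apply: le_trans (TM _ s0 (le_trans st td)) _.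
by rewrite mulrC -ler_pdivlMr// hh.
Qed.

Lemma C0_semigroup_continuous x t : t \in `]0, d[ -> {for t, continuous (fun r => T r x)}.
Proof.
rewrite in_itv/= => /andP[t0 td]; apply/cvgrPdist_le => e e0.
have [h h0 hh] := C0_semigroup_uniform x e0.
have m0 : 0 < Num.min h (Num.min t (d - t)) by rewrite !lt_min h0 t0 subr_gt0.
near=> s.
have : `|t - s| < Num.min h (Num.min t (d - t)).
  near: s; apply/nbhs_ballP; exists (Num.min h (Num.min t (d - t))) => //.
rewrite !lt_min => /and3P[]; rewrite !ltr_norml => /andP[a1 a2] /andP[b1 b2] /andP[c1 c2].
have [st|/ltW ts] := leP s t; last rewrite distrC; apply: hh => //; lra.
Unshelve. all: by end_near. Qed.

(** T(s) transports the first-order expansion of T(.) x at 0 to time s with an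
    error that is uniform in s, so the increments of T(.) x and of the primitive
    of T(.) y differ by arbitrarily small multiples of their length. *)
Lemma W1q_derivative_orbit p (x y : X) : 1 <= p ->
  (r^-1 *: (T r x - x) @[r --> 0^'+] --> y) ->
  W1q_derivative p 0 d (fun t => T t x) (fun t => T t y).
Proof.
move=> p1 gen; have p0 : 0 <= p by exact: le_trans p1.
have TL z : in_Lq p 0 d (fun t => T t z).
  apply: (in_Lq_bounded (m := M * `|z|)) => //; first by rewrite mulr_ge0// ltW.
    by apply: strongly_measurable_continuous => t; exact: C0_semigroup_continuous.
  by move=> t; rewrite in_itv/= => /andP[t0 td]; apply: TM; exact: ltW.
split; [exact: TL|exact: TL|].
have /choice[I hI] : forall t, exists I, t \in `[0, d] -> has_bochner_integral 0 t (fun t => T t y) I.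
  move=> t; have [|tab] := boolP (t \in `[0, d]); last by exists 0.
  rewrite in_itv/= => /andP[t0 td].
  by have [I hI] := in_Lq_has_bochner_integral p1 (in_Lq_sub (lexx _) td (TL y)); exists I.
move=> t t0d; suff <- : I t = T t x - T 0 x by exact: hI.
have [t0 td] : 0 <= t /\ t <= d by move: t0d; rewrite in_itv/= => /andP.
have I0 : I 0 = 0.
  have h0 : 0 \in `[0, d] by rewrite in_itv/= lexx ltW.
  have := has_bochner_integral_norm (lexx 0) (hI 0 h0).
  by rewrite set_itvoo0 integral_set0 lee_fin normr_le0 => /eqP.
suff : (fun t => T t x - I t) t = (fun t => T t x - I t) 0.
  by rewrite /= I0 subr0 => <-; rewrite opprB addrC subrK.
apply/eqP; rewrite -subr_eq0 -normr_le0; apply: (@le0_of_le_mul R _ ((M + 1) * t)).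
  by rewrite mulr_ge0// addr_ge0// ltW.
move=> e e0.
have [h h0 hh] := C0_semigroup_uniform y e0.
have [k k0 hk] : exists2 k, 0 < k & forall r, 0 <= r -> r < k -> `|T r x - x - r *: y| <= e * r.
  move/cvgrPdist_le : gen => /(_ e e0); rewrite near_withinE => /nbhs_ballP[k /= k0 hk].
  exists k => // r r0 rk.
  move: r0; rewrite le_eqVlt => /orP[/eqP <-|r0].
    by rewrite T0 subrr scale0r subr0 normr0 mulr0.
  have /hk/(_ r0) : ball 0 k r by rewrite /ball/= sub0r normrN gtr0_norm.
  rewrite -(ler_pM2l r0) -{1}(gtr0_norm r0) -normrZ scalerBr scalerA divff ?gt_eqF// scale1r.
  by rewrite distrC mulrC [in leRHS]mulrC.
have hk2 : 0 < Num.min h k / 2 by rewrite divr_gt0// lt_min h0.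
have -> : e * ((M + 1) * t) = (fun r => e * ((M + 1) * r)) t - (fun r => e * ((M + 1) * r)) 0.
  by rewrite /= !mulr0 subr0.
apply: (@increments_telescope R X 0 t _ (fun t => T t x - I t)
  (fun r => e * ((M + 1) * r)) t0 hk2) => s r s0 sr rt rs.
have rd := le_trans rt td.
have : r - s < Num.min h k.
  by apply: le_lt_trans rs _; rewrite ltr_pdivrMr// ltr_pMr ?ltr1n// lt_min h0.
rewrite lt_min => /andP[rsh rsk].
have rs0 : 0 <= r - s by rewrite subr_ge0.
have -> : T r x - I r - (T s x - I s) = (T r x - T s x - (r - s) *: T s y) -
    ((I r - I s) - (r - s) *: T s y).
  by rewrite !opprD !opprK addrACA [RHS]addrACA addNr addr0 [- I r + _]addrC.
apply: le_trans (ler_normB _ _) _.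
rewrite -mulrBr -mulrBr mulrCA mulrDl mul1r; apply: lerD.
  have -> : T r x - T s x - (r - s) *: T s y = T s (T (r - s) x - x - (r - s) *: y).
    have e1 : T s (T (r - s) x) = T r x by rewrite -TD// addrC subrK.
    have e2 : T s ((r - s) *: y) = (r - s) *: T s y by rewrite linearZ.
    rewrite (linearB (T s) (T (r - s) x - x)) (linearB (T s) (T (r - s) x)).
    by rewrite e1 e2.
  apply: le_trans (TM _ s0 (le_trans sr rd)) _.
  by rewrite ler_pM2l// hk.
have hs : s \in `[0, d] by rewrite in_itv/= s0 (le_trans sr).
have hr : r \in `[0, d] by rewrite in_itv/= rd (le_trans s0).
have hsr := has_bochner_integral_subinterval s0 sr (hI r hr) (hI s hs).
rewrite -lee_fin; apply: le_trans (has_bochner_integral_dist hsr (has_bochner_integral_cst (T s y) sr)) _.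
rewrite -integral_cst_itv//; apply: ae_integral_le => [//|_|]; first exact: ltW.
apply: aeW => q; rewrite in_itv/= => /andP[sq qr]; apply: hh => //; first exact: ltW.
  by apply: le_trans rd; exact: ltW.
by apply: lt_trans rsh; rewrite ltrD2r.
Qed.

End LocallyBounded.
End Semigroups.

(** * Semigroup orbits have maximal regularity *)
Section SemigroupOrbits.
Context {R : realType} {X D : completeNormedModType R} (j : {linear D -> X}).
Hypothesis j_inj : injective j.
Variables (p : R) (B : {linear D -> X}).
Hypotheses (p1 : 1 < p) (B_cont : continuous B) (B_MR : maximal_regularity j B).
Local Notation mu := (@lebesgue_measure R).

Let p0 : 0 <= p. Proof. exact: le_trans ler01 (ltW p1). Qed.

Lemma to_DK d : to_D j (j d) = d.
Proof. by rewrite /to_D; case: xgetP => [e _ /j_inj //|/(_ d)]; case. Qed.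

Lemma powR_le_root (x y C : R) : 0 <= x -> 0 <= y -> 0 <= C ->
  x `^ p <= C * y `^ p -> x <= C `^ p^-1 * y.
Proof.
move=> x0 y0 C0 xy; have pp : p * p^-1 = 1 by rewrite divff// gt_eqF// (lt_trans ltr01).
have ip : 0 <= p^-1 by rewrite invr_ge0.
have root z : 0 <= z -> (z `^ p) `^ p^-1 = z by move=> z0; rewrite -powRrM pp powRr1.
rewrite -(root x x0) -[y in leRHS](root y y0) -powRM ?powR_ge0//.
by apply: ge0_ler_powR; rewrite ?nnegrE ?mulr_ge0 ?powR_ge0.
Qed.

Lemma power_integral_cst (E : completeNormedModType R) a b (x : E) : a <= b ->
  power_integral p a b (cst x) = (`|x| `^ p * (b - a))%:E.
Proof. by move=> ab; exact: (integral_cst_itv (`|x| `^ p) ab). Qed.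

(** The function t |-> t d starts from rest and solves the equation with right-hand
    side j d + t B d. *)
Lemma graph_norm_bound : exists2 c : R, 0 < c & forall d, `|d| <= c * (`|j d| + `|B d|).
Proof.
have [L [K [L0 K0 est]]] := maximal_regularity_estimate j_inj p1 B_cont B_MR.
pose C := (2 * K) `^ p^-1 * (1 + L).
exists (2 / L * C + 1) => [|d].
  by rewrite ltr_wpDl// mulr_ge0 ?divr_ge0 ?mulr_ge0 ?addr_ge0 ?powR_ge0 ?ltW.
pose m := `|j d| + `|B d|.
have m0 : 0 <= m by rewrite addr_ge0.
have M := MR_dataM (ltW p1) (ltW L0) (MR_data_cst j 0 L d p0).
have := est _ _ _ _ _ L0 _ M; rewrite subr0 subrr scale0r => /(_ (lexx _) erefl) le1.
(* On the second half of (0, L) the function t d is at least (L / 2) d in norm. *)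
have low : (power_integral p (L / 2) L (cst ((L / 2) *: d)) <=
    power_integral p 0 L (fun t => ((t - 0) *: cst d t)%R))%E.
  have L2 : 0 <= L / 2 by rewrite divr_ge0// ltW.
  apply: le_trans (power_integral_sub p _ L2 (lexx L)).
  apply: power_integral_le => //; apply: aeW => t; rewrite in_itv/= => /andP[Lt _].
  rewrite /= subr0 !normrZ ler_wpM2r// !ger0_norm ?ltW//.
  exact: le_lt_trans Lt.
have up : (power_integral p 0 L (fun t => ((t - 0) *: cst 0 t + cst (j d) t + B ((t - 0) *: cst d t))%R)
    <= (((1 + L) * m) `^ p * (L - 0))%:E)%E.
  apply: power_integral_bound => //; [exact: ltW|by rewrite mulr_ge0// addr_ge0// ltW|].
  move=> t; rewrite in_itv/= => /andP[t0 tL].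
  rewrite /= scaler0 add0r subr0 linearZ; apply: le_trans (ler_normD _ _) _.
  rewrite normrZ (gtr0_norm t0) /m mulrDl mul1r; apply: lerD; first by rewrite lerDl.
  by apply: ler_pM => //; [exact: ltW|exact: ltW|rewrite lerDr].
have := le_trans low (le_trans le1 (lee_wpmul2l _ up)).
rewrite lee_fin => /(_ (ltW K0)).
rewrite power_integral_cst; last by rewrite ler_pdivrMr// ler_pMr// ler1n.
rewrite -EFinM lee_fin subr0 => main.
have {}main : `|(L / 2) *: d| `^ p <= (2 * K) * ((1 + L) * m) `^ p.
  have L2 : L - L / 2 = L / 2 by lra.
  rewrite L2 in main; rewrite -(ler_pM2r (divr_gt0 L0 (ltr0n _ 2))).
  apply: le_trans main _.
  by rewrite le_eqVlt; apply/orP; left; apply/eqP; lra.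
have := powR_le_root (normr_ge0 _) _ _ main.
rewrite !mulr_ge0 ?addr_ge0 ?(ltW L0) ?(ltW K0)// => /(_ isT isT).
rewrite normrZ gtr0_norm ?divr_gt0// -ler_pdivlMl ?divr_gt0// invf_div => le2.
apply: le_trans le2 _; rewrite [leRHS]mulrDl -/m mul1r /C !mulrA lerDl//.
Qed.

Section Orbits.
Variable T : R -> {linear X -> X}.
Hypothesis T_gen : semigroup_generated j B T.
Variables (d M : R).
Hypotheses (d0 : 0 < d) (M0 : 0 < M).
Hypothesis TM : forall r x, 0 <= r -> r <= d -> `|T r x| <= M * `|x|.

Lemma generator_cvg (x : D) : r^-1 *: (T r (j x) - j x) @[r --> 0^'+] --> - B x.
Proof. by apply/(T_gen.2 (j x) (- B x)); exists x. Qed.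

(** T(t) commutes with the difference quotients at 0, and the generator of T is
    exactly - B. *)
Lemma semigroup_domain (x : D) t : 0 <= t ->
  j (to_D j (T t (j x))) = T t (j x) /\ B (to_D j (T t (j x))) = T t (B x).
Proof.
move=> t0; have [[T_cont T0 TD _] _] := T_gen.
have cv : r^-1 *: (T r (T t (j x)) - T t (j x)) @[r --> 0^'+] --> - T t (B x).
  have -> : - T t (B x) = T t (- B x) by rewrite linearN.
  have h : T t (r^-1 *: (T r (j x) - j x)) @[r --> 0^'+] --> T t (- B x).
    exact: (cvg_comp _ _ (@generator_cvg x) (T_cont t t0 _)).
  apply: cvg_trans h; apply: near_eq_cvg; near=> r.
  have r0 : 0 <= r by apply: ltW; near: r; exact: nbhs_right_gt.
  by rewrite linearZ linearB -!TD// [t + r]addrC.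
have [y jy By] := (T_gen.2 _ _).1 cv.
rewrite jy to_DK; split => //.
by have := congr1 (fun z => - z) By; rewrite !opprK.
Unshelve. all: by end_near. Qed.

(** T(.) (j x) and T(.) (B x) are continuous in X, so by the graph norm bound the
    orbit is continuous in D. *)
Lemma MR_data_orbit (x : D) : MR_data j p 0 d (fun t => T t (j x)) (fun t => T t (- B x))
  (fun t => to_D j (T t (j x))).
Proof.
have C0 := T_gen.1.
have [c c0 hc] := graph_norm_bound.
pose w t := to_D j (T t (j x)).
split.
- exact: (W1q_derivative_orbit C0 d0 M0 TM (ltW p1) (@generator_cvg x)).
- apply: (in_Lq_bounded (m := c * (M * `|j x| + M * `|B x|))) => //.
  + by rewrite mulr_ge0 ?addr_ge0 ?mulr_ge0// ltW.
  + apply: strongly_measurable_continuous => t t0d.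
    have c1 : {for t, continuous (fun r => T r (j x))}.
      exact: (C0_semigroup_continuous C0 M0 TM).
    have c2 : {for t, continuous (fun r => T r (B x))}.
      exact: (C0_semigroup_continuous C0 M0 TM).
    apply/cvgrPdist_le => e e0; have ec : 0 < e / c / 2 by rewrite !divr_gt0.
    have n1 : \forall s \near t, `|T t (j x) - T s (j x)| <= e / c / 2.
      by move/cvgrPdist_le : c1; exact.
    have n2 : \forall s \near t, `|T t (B x) - T s (B x)| <= e / c / 2.
      by move/cvgrPdist_le : c2; exact.
    have n3 : \forall s \near t, 0 < s.
      move: t0d; rewrite in_itv/= => /andP[t0 _]; exact: lt_nbhsr.
    near=> s.
    have s0 : 0 <= s by apply: ltW; near: s.
    have t0 : 0 <= t by move: t0d; rewrite in_itv/= => /andP[/ltW].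
    have [js Bs] := @semigroup_domain x s s0; have [jt Bt] := @semigroup_domain x t t0.
    apply: le_trans (hc _) _; rewrite !linearB jt js Bt Bs.
    rewrite -ler_pdivlMl// mulrC.
    have -> : e / c = e / c / 2 + e / c / 2 by lra.
    by apply: lerD; near: s.
  + move=> t; rewrite in_itv/= => /andP[/ltW t0 /ltW td].
    have [jt Bt] := @semigroup_domain x t t0.
    apply: le_trans (hc _) _; rewrite jt Bt ler_pM2l//.
    by apply: lerD; exact: TM.
- apply: aeW => t; rewrite in_itv/= => /andP[/ltW t0 _].
  by have [-> _] := @semigroup_domain x t t0.
Unshelve. all: by end_near. Qed.

End Orbits.
End SemigroupOrbits.

(** * The non-autonomous problem *)
Section NonAutonomousProblem.
Context {R : realType} {X D Y : completeNormedModType R}.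
Variables (tau : R) (j : {linear D -> X}) (A : R -> {linear D -> X}).
Hypothesis j_inj : injective j.
Hypothesis A_cont : forall t, t \in `[0, tau] -> continuous (A t).
Hypothesis A_lip : forall t s x, t \in `[0, tau] -> s \in `[0, tau] ->
  `|A t x - A s x| <= `|t - s| * `|x|.
Hypothesis A_MR : forall t, t \in `[0, tau] -> maximal_regularity j (A t).
Variable p : R.
Hypothesis p1 : 1 < p.
Local Notation mu := (@lebesgue_measure R).

Let p0 : 0 <= p. Proof. exact: le_trans ler01 (ltW p1). Qed.
Let p_gt0 : 0 < p. Proof. exact: lt_trans ltr01 p1. Qed.

(** The function z = (t - a) u solves z' + A(t0) z = (A(t0) - A(t)) z + u with
    z(a) = 0, and the first term on the right is absorbed when |t - t0| is
    small. *)
Lemma smoothing_estimate t0 : t0 \in `[0, tau] ->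
  exists rho K, [/\ 0 < rho, 0 < K &
    forall a b u g v, 0 <= a -> a < b -> b <= tau -> t0 - rho <= a -> b <= t0 + rho ->
      MR_data j p a b u g v ->
      {ae mu, forall t, t \in `]a, b[ -> g t + A t (v t) = 0} ->
      (power_integral p a b (fun t => ((t - a) *: v t)%R) <= K%:E * power_integral p a b u)%E].
Proof.
move=> ht0.
have [L [K [L0 K0 est]]] := maximal_regularity_estimate j_inj p1 (A_cont ht0) (A_MR ht0).
have pp : 0 < 2 `^ p :> R by exact: powR_gt0.
(* With this eta, the term to be absorbed is at most half of the left-hand side. *)
pose eta := (1 / (2 * (K * 2 `^ p))) `^ p^-1.
have Kp : 0 < 2 * (K * 2 `^ p) by rewrite !mulr_gt0.
have eta0 : 0 < eta by rewrite powR_gt0 ?divr_gt0.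
have etap : eta `^ p = 1 / (2 * (K * 2 `^ p)).
  by rewrite -powRrM mulVf ?gt_eqF// powRr1 ?divr_ge0// ltW.
exists (Num.min (L / 2) eta), (2 * (K * 2 `^ p)); split => //.
  by rewrite lt_min eta0 divr_gt0.
move=> a b u g v a0 ab btau.
rewrite lerBlDr -lerBlDl => ta bt; have {ta}: t0 - a <= L / 2 /\ t0 - a <= eta.
  by move: ta; rewrite le_min => /andP.
move=> [taL taE]; have {bt} : b - t0 <= L / 2 /\ b - t0 <= eta.
  by move: bt; rewrite -lerBlDl le_min => /andP.
move=> [btL btE] M eq0.
have baL : b - a <= L by lra.
have MZ := MR_dataM (ltW p1) (ltW ab) M.
have := est _ _ _ _ _ ab baL MZ; rewrite subrr scale0r => /(_ erefl) le1.
have [_ ZL _] := MZ; have [[uL _ _] _ _] := M.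
have [z z0 zE] := power_integral_fin ZL; have [w w0 wE] := power_integral_fin uL.
have [mZ _] := ZL; have [mu_ _] := uL.
have le2 : (power_integral p a b (fun t => ((t - a) *: g t + u t + A t0 ((t - a) *: v t))%R) <=
   (2 `^ p)%:E * (power_integral p a b (fun t => (eta *: ((t - a) *: v t))%R) + power_integral p a b u))%E.
  apply: power_integral_leD => //; first exact: strongly_measurableZ.
  apply: filterS eq0 => t e tab.
  have [at_ tb] : a < t /\ t < b by move: tab; rewrite in_itv/= => /andP.
  have tI : t \in `[0, tau] by rewrite in_itv/= (le_trans a0 (ltW at_)) (le_trans (ltW tb) btau).
  have -> : (t - a) *: g t + u t + A t0 ((t - a) *: v t) =
      (t - a) *: (A t0 (v t) - A t (v t)) + u t.
    have gE : g t = - A t (v t) by apply/eqP; rewrite -addr_eq0 e.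
    by rewrite linearZ/= gE scalerBr scalerN addrAC [- _ + _]addrC.
  apply: le_trans (ler_normD _ _) _; rewrite lerD2r normrZ [leRHS]normrZ (gtr0_norm eta0) normrZ.
  rewrite mulrCA ler_wpM2l//; apply: le_trans (A_lip _ ht0 tI) _.
  by rewrite ler_wpM2r// ler_norml; apply/andP; split; lra.
have {}le2 : (power_integral p a b (fun t => ((t - a) *: g t + u t + A t0 ((t - a) *: v t))%R) <=
    (2 `^ p * (1 / (2 * (K * 2 `^ p)) * z + w))%:E)%E.
  apply: le_trans le2 _; rewrite power_integralZ// zE wE (gtr0_norm eta0) etap.
  exact: lexx.
have := le_trans le1 (lee_wpmul2l _ le2); rewrite lee_fin => /(_ (ltW K0)).
rewrite zE wE -!EFinM !lee_fin => main.
have e1 : K * (2 `^ p * (1 / (2 * (K * 2 `^ p)) * z + w)) = z / 2 + K * 2 `^ p * w.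
  by field; rewrite !gt_eqF.
by rewrite e1 in main; lra.
Qed.

Variable C : {linear D -> Y}.
Hypothesis C_cont : continuous C.

(** Comparison with the semigroup frozen at time s: the difference of the orbits
    is handled by the estimate of maximal regularity and the smoothing effect,
    the semigroup orbit by its admissibility.  The constant serves all
    orbits bounded by M |x| in X. *)
Lemma initial_estimate s (T : R -> {linear X -> X}) (M : R) :
  0 <= s -> s < tau -> semigroup_generated j (A s) T -> admissible j p C T -> 0 < M ->
  exists d K, [/\ 0 < d, s + d <= tau, 0 <= K &
    forall (x : D) u g v, MR_data j p s tau u g v -> u s = j x ->
      {ae mu, forall t, t \in `]s, tau[ -> g t + A t (v t) = 0} ->
      (forall t, t \in `]s, tau[ -> `|u t| <= M * `|j x|) ->
      (power_integral p s (s + d) (fun t => C (v t)) <= (K * `|j x| `^ p)%:E)%E].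
Proof.
move=> s0 stau gen [a a0 [gam gam0 adm]] M0.
have sI : s \in `[0, tau] by rewrite in_itv/= s0 ltW.
have [L [K [L0 K0 est]]] := maximal_regularity_estimate j_inj p1 (A_cont sI) (A_MR sI).
have [rho [K' [rho0 K'0 smooth]]] := smoothing_estimate sI.
have [ds [Ms [ds0 Ms0 TM]]] := C0_semigroup_bound gen.1.
have [c c0 Cc] := continuous_linear_bound C_cont.
pose d := Num.min L (Num.min rho (Num.min ds (Num.min a (tau - s)))).
have d0 : 0 < d by rewrite !lt_min L0 rho0 ds0 a0 subr_gt0.
have : d <= d by []; rewrite {2}/d !le_min => /and5P[dL drho dds da dtau].
have sdtau : s + d <= tau by rewrite -lerBrDl.
have sd : s < s + d by rewrite ltrDl.
pose K1 := K * (K' * (M `^ p * d)).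
exists d, (2 `^ p * (c `^ p * K1 + gam `^ p)); split => //.
  by rewrite !(mulr_ge0, addr_ge0, powR_ge0)// ltW.
move=> x u g v M1 us eq0 uM.
have Mu := MR_data_sub (lexx s) (ltW sd) sdtau M1.
have [_ orbL _] := MR_data_orbit j_inj p1 (A_cont sI) (A_MR sI) gen ds0 Ms0 TM x.
have MT : MR_data j p s (s + d) (fun t => T (t - s) (j x)) (fun t => T (t - s) (- A s x))
    (fun t => to_D j (T (t - s) (j x))).
  have := MR_data_translation s (MR_data_sub (lexx 0) (ltW d0) dds
    (MR_data_orbit j_inj p1 (A_cont sI) (A_MR sI) gen ds0 Ms0 TM x)).
  by rewrite add0r [d + s]addrC.
have Mw := MR_dataD (-1) p0 Mu MT.
have eq0' := ae_subinterval (lexx s) sdtau eq0.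
have sdL : s + d - s <= L by rewrite addrC addKr.
have := est _ _ _ _ _ sd sdL Mw.
have T0 y : T 0 y = y by case: gen => -[].
rewrite subrr T0 us scaleN1r subrr => /(_ erefl) le1.
have le2 : (power_integral p s (s + d) (fun t => (g t + -1 *: T (t - s) (- A s x) +
      A s (v t + -1 *: to_D j (T (t - s) (j x))))%R) <=
    power_integral p s (s + d) (fun t => ((t - s) *: v t)%R))%E.
  apply: power_integral_le => //; apply: filterS eq0' => t e ts.
  have [st tsd] : s < t /\ t < s + d by move: ts; rewrite in_itv/= => /andP.
  have ts0 : 0 <= t - s by rewrite subr_ge0 ltW.
  have tI : t \in `[0, tau] by rewrite in_itv/= (le_trans s0 (ltW st)) (le_trans (ltW tsd) sdtau).
  have [_ AT] := semigroup_domain j_inj gen x ts0.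
  have -> : g t + -1 *: T (t - s) (- A s x) + A s (v t + -1 *: to_D j (T (t - s) (j x))) =
      A s (v t) - A t (v t).
    have gE : g t = - A t (v t) by apply/eqP; rewrite -addr_eq0 e.
    rewrite gE linearD linearZ/= AT linearN/= !scaleN1r opprK.
    by rewrite addrACA subrr addr0 addrC.
  by rewrite normrZ distrC; exact: A_lip.
have bnd : (power_integral p s (s + d) u <= ((M * `|j x|) `^ p * (s + d - s))%:E)%E.
  apply: power_integral_bound => //; [exact: ltW|by rewrite mulr_ge0// ltW|].
  move=> t; rewrite in_itv/= => /andP[st tsd]; apply: uM.
  by rewrite in_itv/= st (lt_le_trans tsd).
have le3 : (power_integral p s (s + d) (fun t => (v t + -1 *: to_D j (T (t - s) (j x)))%R)
    <= (K1 * `|j x| `^ p)%:E)%E.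
  apply: le_trans le1 _.
  have -> : (K1 * `|j x| `^ p)%:E = (K%:E * (K'%:E * ((M * `|j x|) `^ p * (s + d - s))%:E))%E.
    rewrite -!EFinM /K1 powRM ?(ltW M0)//; congr EFin.
    by rewrite [s + d]addrC addrK; ring.
  apply: lee_wpmul2l; first by rewrite lee_fin ltW.
  apply: le_trans le2 _; apply: le_trans (smooth _ _ _ _ _ s0 sd sdtau _ _ Mu eq0') _.
  - by rewrite lerBlDr lerDl ltW.
  - by rewrite lerD2l.
  by apply: lee_wpmul2l => //; rewrite lee_fin ltW.
have [_ [mw _] _] := Mw; have [_ [mT _] _] := MT.
have mCT := strongly_measurable_comp C_cont mT.
apply: le_trans (power_integral_leD (g := fun t => c *: (v t + -1 *: to_D j (T (t - s) (j x))))
  (h := fun t => C (to_D j (T (t - s) (j x)))) p0 _ mCT _) _.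
- exact: strongly_measurableZ.
- apply: aeW => t _; rewrite normrZ (gtr0_norm c0).
  apply: le_trans (lerD (Cc _) (lexx _)).
  rewrite linearD linearZ/= scaleN1r; apply: le_trans (ler_normD _ _).
  by rewrite subrK.
rewrite -[leRHS]/((2 `^ p * (c `^ p * K1 + gam `^ p) * `|j x| `^ p)%:E).
rewrite -mulrA EFinM; apply: lee_wpmul2l; first by rewrite lee_fin powR_ge0.
rewrite mulrDl EFinD; apply: leeD.
  rewrite power_integralZ// (gtr0_norm c0) -mulrA EFinM.
  by apply: lee_wpmul2l; first by rewrite lee_fin powR_ge0.
have mCT0 : strongly_measurable 0 d (fun t => C (to_D j (T t (j x)))).
  by apply: (strongly_measurable_comp C_cont); apply: strongly_measurable_sub (lexx 0) dds orbL.1.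
have := power_integral_translation p s mCT0; rewrite add0r [d + s]addrC => ->.
exact: le_trans (power_integral_sub p _ (lexx 0) da) (adm x).
Qed.

(** Each orbit is continuous on a compact interval, hence bounded, so the uniform
    boundedness principle applies. *)
Lemma evolution_operator_bound (U : R -> R -> {linear X -> X}) s :
  evolution_family tau U -> 0 <= s -> s <= tau ->
  exists2 M : R, 0 < M & forall t x, t \in `[s, tau] -> `|U t s x| <= M * `|x|.
Proof.
move=> [U_cont _ _ U_sc] s0 stau.
have [t|x|M M0 hM] := @uniform_operator_bound R X R (fun t => t \in `[s, tau]) (fun t => U t s).
- by rewrite in_itv/= => /andP[st tt]; exact: U_cont.
- pose seg : set (R * R) := (fun t => (t, s)) @` `[s, tau].
  have cseg : compact seg.
    apply: continuous_compact; last exact: segment_compact.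
    apply: continuous_subspaceT => t.
    apply: (@cvg_pair _ _ _ (nbhs t) (nbhs t) (nbhs s) _ _ _ id (cst s)).
      exact: cvg_id.
    exact: cvg_cst.
  have wseg : {within seg, continuous (fun q : R * R => U q.1 q.2 x)}.
    apply: continuous_subspaceW (U_sc x) => _ [t /= + <-] /=.
    by rewrite in_itv/= => /andP[st tt].
  have /compact_bounded := continuous_compact wseg cseg.
  move=> /pinfty_ex_gt0[M M0 hM]; exists M => t ht.
  by apply: hM; exists (t, s) => //; exists t.
exists M => // t x ht; exact: hM.
Qed.

End NonAutonomousProblem.

(** Applied at the supremum of the times reached so far, the step goes beyond that
    supremum unless it is b. *)
Lemma real_induction (R : realType) (a b : R) (P : R -> Prop) (c : R) :
  a < c -> c <= b -> P c ->
  (forall t, a < t -> t <= b -> exists2 r, 0 < r &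
     forall t', a < t' -> t - r <= t' -> t' <= t -> P t' -> P (Num.min (t + r) b)) ->
  P b.
Proof.
move=> ac cb Pc step.
pose E := [set t | [/\ a < t, t <= b & P t]].
have Ec : E c by [].
have supE : has_sup E by split; [exists c|exists b => t []].
have csup : c <= sup E by exact: ub_le_sup supE.2 _ Ec.
have supb : sup E <= b by apply: ge_sup; [exists c|move=> t []].
have [r r0 hr] := step (sup E) (lt_le_trans ac csup) supb.
have [t' [at' t'b Pt'] lt'] := sup_adherent r0 supE.
have t'sup : t' <= sup E by exact: ub_le_sup supE.2 _ _.
have Pm := hr t' at' (ltW lt') t'sup Pt'.
have [bs|sb] := leP b (sup E + r); first by rewrite (min_idPr bs) in Pm.
rewrite (min_idPl (ltW sb)) in Pm.
have : sup E + r <= sup E.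
  apply: ub_le_sup supE.2 _ _; split => //; last exact: ltW.
  by rewrite (lt_le_trans ac)// (le_trans csup)// lerDl ltW.
by rewrite gerDl leNgt r0.
Qed.

Theorem mainTheorem3 (R : realType) (X D Y : completeNormedModType R)
  (tau : R) (tau_gt0 : 0 < tau)
  (* continuous dense embedding of D into X *)
  (j : {linear D -> X}) (j_inj : injective j) (j_cont : continuous j)
  (j_dense : dense (range j))
  (* A : [0, tau] -> L(D, X), Lipschitz, with values in MR *)
  (A : R -> {linear D -> X})
  (A_cont : forall t, t \in `[0, tau] -> continuous (A t))
  (A_lip : forall t s x, t \in `[0, tau] -> s \in `[0, tau] ->
     `|A t x - A s x| <= `|t - s| * `|x|)
  (A_MR : forall t, t \in `[0, tau] -> maximal_regularity j (A t))
  (C : {linear D -> Y}) (C_cont : continuous C)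
  (* S t r = e^{- r A(t)} *)
  (S : R -> R -> {linear X -> X})
  (S_gen : forall t, t \in `[0, tau] -> semigroup_generated j (A t) (S t))
  (* the evolution family of A *)
  (U : R -> R -> {linear X -> X})
  (U_evol : evolution_family tau U)
  (U_sol : solves_Cauchy_problem j tau A U) :
  forall p : R, 1 < p ->
    (forall t, t \in `[0, tau] -> admissible j p C (S t)) ->
    evolution_admissible j p tau C U.
Proof.
move=> p p1 adm s s0 stau.
have p0 : 0 <= p by exact: le_trans ler01 (ltW p1).
have sI : s \in `[0, tau] by rewrite in_itv/= s0 ltW.
have [M M0 UM] := evolution_operator_bound U_evol s0 (ltW stau).
have [c c0 Cc] := continuous_linear_bound C_cont.
pose y (x : D) t : Y := C (to_D j (U t s (j x))).
have orbit (x : D) : exists u g v, [/\ MR_data j p s tau u g v, u s = j x,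
    {ae lebesgue_measure, forall t, t \in `]s, tau[ -> g t + A t (v t) = 0},
    forall t, t \in `]s, tau[ -> `|u t| <= M * `|j x| &
    {ae lebesgue_measure, forall t, t \in `]s, tau[ -> y x t = C (v t)}].
  have tr : trace_space j p s tau (j x).
    exists (cst (j x)); split => //; exists (cst 0), (cst x).
    exact: MR_data_cst.
  have [[u [[g [v [M1 eq0]]] us]] uniq] := U_sol s p (j x) s0 stau p1 tr.
  have uE t : t \in `[s, tau] -> U t s (j x) = u t.
    by apply: (uniq u) => //; exists g, v.
  exists u, g, v; split => //.
    move=> t ht; have ht' : t \in `[s, tau] by apply: subset_itv_oo_cc.
    by rewrite -uE//; exact: UM.
  have [_ _ uv] := M1; apply: filterS uv => t e ht.
  have ht' : t \in `[s, tau] by apply: subset_itv_oo_cc.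
  by rewrite /y uE// e// to_DK.
pose P b := exists2 K, 0 <= K & forall x : D,
  (power_integral p s b (y x) <= (K * `|j x| `^ p)%:E)%E.
have P_tau : P tau.
  have [d [K [d0 sd K0 hK]]] := initial_estimate j_inj A_cont A_lip A_MR p1 C_cont s0 stau
    (S_gen s sI) (adm s sI) M0.
  apply: (@real_induction R s tau P (s + d)) => //; first by rewrite ltrDl.
    exists K => // x; have [u [g [v [M1 us eq0 uM yE]]]] := orbit x.
    rewrite (@power_integral_ae _ _ p s (s + d) _ (fun t => C (v t))); last first.
      by apply: filterS (ae_subinterval (lexx s) sd yE) => t e ht; rewrite e.
    exact: hK M1 us eq0 uM.
  move=> t st ttau.
  have tI : t \in `[0, tau] by rewrite in_itv/= ttau (le_trans s0 (ltW st)).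
  have [rho [K' [rho0 K'0 smooth]]] := smoothing_estimate j_inj A_cont A_lip A_MR p1 tI.
  pose r := Num.min (rho / 2) ((t - s) / 2).
  have r0 : 0 < r by rewrite lt_min !divr_gt0// subr_gt0.
  have : r <= r by []; rewrite {2}/r le_min => /andP[rrho rts].
  exists r => // t' st' tr tt' [K1 K10 hK1].
  (* The window starts at a distance 2 r before t, so that q - a >= r when
     q >= t - r. *)
  pose a := t - 2 * r; pose b := Num.min (t + r) tau.
  have btau : b <= tau by rewrite /b ge_min lexx orbT.
  have btr : b <= t + r by rewrite /b ge_min lexx.
  have tb : t <= b by rewrite /b le_min ttau lerDl ltW.
  have sa : s <= a by rewrite /a; lra.
  have at' : a + r <= t' by rewrite /a; lra.
  have ab : a < b by rewrite /a; lra.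
  have t'b : t' <= b by exact: le_trans tb.
  exists (K1 + (c / r) `^ p * (K' * (M `^ p * (b - a)))).
    have ba0 : 0 <= b - a by rewrite subr_ge0 ltW.
    by rewrite addr_ge0// mulr_ge0 ?powR_ge0// mulr_ge0 ?(ltW K'0)// mulr_ge0 ?powR_ge0.
  move=> x; have [u [g [v [M1 us eq0 uM yE]]]] := orbit x.
  have my : strongly_measurable s b (y x).
    apply: (strongly_measurable_sub (lexx s) btau); have [_ [mv _] _] := M1.
    apply: strongly_measurable_ae (strongly_measurable_comp C_cont mv).
    by apply: filterS yE => q e hq; rewrite e.
  rewrite (power_integral_split p (ltW st') t'b my) mulrDl EFinD; apply: leeD => //.
  have M2 := MR_data_sub sa (ltW ab) btau M1.
  have eq2 := ae_subinterval sa btau eq0.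
  have bnd : (power_integral p a b u <= ((M * `|j x|) `^ p * (b - a))%:E)%E.
    apply: power_integral_bound => //; [exact: ltW|by rewrite mulr_ge0// ltW|].
    move=> q; rewrite in_itv/= => /andP[aq qb]; apply: uM.
    by rewrite in_itv/= (le_lt_trans sa aq) (lt_le_trans qb btau).
  have sm := smooth a b u g v (le_trans s0 sa) ab btau _ _ M2 eq2.
  have [_ [mv _] _] := MR_dataM (ltW p1) (ltW ab) M2.
  apply: (@le_trans _ _ (power_integral p a b (fun q => ((c / r) *: ((q - a) *: v q))%R))).
    apply: le_trans (power_integral_sub p _ (_ : a <= t') (lexx b)); last by lra.
    apply: power_integral_le => //.
    apply: filterS (ae_subinterval (ltW st') btau yE) => q e hq.
    have [t'q qb] : t' < q /\ q < b by move: hq; rewrite in_itv/= => /andP.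
    rewrite e//; apply: le_trans (Cc _) _.
    have rq : r <= q - a by lra.
    rewrite normrZ (gtr0_norm (divr_gt0 c0 r0)) normrZ (gtr0_norm (lt_le_trans r0 rq)).
    rewrite mulrA ler_wpM2r// mulrAC ler_pdivlMr// ler_pM2l//.
  rewrite (power_integralZ _ p0 mv) (gtr0_norm (divr_gt0 c0 r0)) -mulrA EFinM.
  apply: lee_wpmul2l; first by rewrite lee_fin powR_ge0.
  apply: le_trans (sm _ _) _; [by rewrite /a; lra|by lra|].
  rewrite -mulrA EFinM; apply: lee_wpmul2l; first by rewrite lee_fin ltW.
  by apply: le_trans bnd _; rewrite lee_fin powRM ?(ltW M0)// mulrAC.
have [K K0 hK] := P_tau.
exists ((K + 1) `^ p^-1); first by rewrite powR_gt0// ltr_wpDl.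
move=> x; rewrite -powRrM mulVf ?gt_eqF ?(lt_trans ltr01)//.
rewrite powRr1 ?addr_ge0//; apply: le_trans (hK x) _.
by rewrite lee_fin ler_wpM2r ?powR_ge0// lerDl.
Qed.
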